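(* For every infinite field $K$, the first-order theory $T_K$ eliminates quantifiers in the language $L_K$ and is complete.
   Context: Let $K$ be an infinite field. Let $L_{K\text{-vs}} = \{+,0,\lambda\cdot \mid \lambda\in K\}$ be the language of $K$-vector spaces, and let $L_K$ be $L_{K\text{-vs}}$ together with unary predicates $X^n$ for $n\in\omega$; write $X := X^1$. The $L_K$-theory $T_K$ is axiomatised as follows. (1) The reduct to $L_{K\text{-vs}}$ is a $K$-vector space. (2) $X$ is closed under multiplication by every $\lambda\in K$. (3) Each $X^n$ is interpreted as the $n$-fold sum $\{x_0+\dots+x_{n-1}\mid x_j\in X\}$, with the convention $X^0=\{0\}$. (4) The parallelism relation $x\parallel y :\Leftrightarrow x+y\in X$ is an equivalence relation on $X\setminus\{0\}$; the union of an equivalence class with $\{0\}$ is called an axis. (5) There are infinitely many axes. (6) The axes are linearly independent: if $Y_0,\dots,Y_n$ are pairwise distinct axes and $a_i\in Y_i\setminus\{0\}$, then $a_0,\dots,a_n$ are linearly independent. *)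

(* Defs.v *)
From mathcomp Require Import all_boot all_algebra.
From mathcomp Require Import boolp classical_sets cardinality.

Set Implicit Arguments.
Unset Strict Implicit.
Unset Printing Implicit Defensive.

Import GRing.Theory.

Record language := Language {
  fun_symb : Type;
  fun_arity : fun_symb -> nat;
  rel_symb : Type;
  rel_arity : rel_symb -> nat
}.

Section Syntax.
Variable L : language.

(* Terms and formulas are well scoped: [term L n] and [formula L n] have their
   free variables among x_0, ..., x_(n-1). *)
Inductive term (n : nat) : Type :=
| Var of 'I_n
| App (f : fun_symb L) of ('I_(fun_arity f) -> term n).

(* de Bruijn: the quantifiers bind x_0 of their body, and x_(i+1) of the body
   is x_i of the quantified formula. *)
Inductive formula (n : nat) : Type :=
| Bot
| Eq of term n & term n
| Rel (R : rel_symb L) of ('I_(rel_arity R) -> term n)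
| And of formula n & formula n
| Or of formula n & formula n
| Imp of formula n & formula n
| All of formula n.+1
| Ex of formula n.+1.

Definition sentence := formula 0.

Fixpoint quantifier_free n (phi : formula n) : Prop :=
  match phi with
  | Bot | Eq _ _ | Rel _ _ => True
  | And p q | Or p q | Imp p q => quantifier_free p /\ quantifier_free q
  | All _ | Ex _ => False
  end.

End Syntax.

Arguments Var {L n} _.
Arguments App {L n} f _.
Arguments Bot {L n}.
Arguments Rel {L n} R _.

Section DerivedSyntax.
Variable L : language.

Definition Not n (p : formula L n) : formula L n := Imp p Bot.
Definition Top n : formula L n := Not Bot.
Definition Iff n (p q : formula L n) : formula L n := And (Imp p q) (Imp q p).

(* [Alls k] and [Exs k] bind x_0, ..., x_(k-1); the variable x_(k+j) of the body
   is x_j of the resulting formula. *)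
Fixpoint Alls k n : formula L (k + n) -> formula L n :=
  if k is k'.+1 then fun p => @Alls k' n (All p) else id.

Fixpoint Exs k n : formula L (k + n) -> formula L n :=
  if k is k'.+1 then fun p => @Exs k' n (Ex p) else id.

Definition v0 n : term L n.+1 := Var ord0.
Definition v1 n : term L n.+2 := Var (lift ord0 ord0).
Definition v2 n : term L n.+3 := Var (lift ord0 (lift ord0 ord0)).

End DerivedSyntax.

Arguments Top {L n}.
Arguments Alls {L} k {n} _.
Arguments Exs {L} k {n} _.
Arguments v0 {L n}.
Arguments v1 {L n}.
Arguments v2 {L n}.

Record structure (L : language) := Structure {
  carrier :> Type;
  carrier_inhabited : inhabited carrier;
  fun_interp : forall f : fun_symb L, ('I_(fun_arity f) -> carrier) -> carrier;
  rel_interp : forall R : rel_symb L, ('I_(rel_arity R) -> carrier) -> Prop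
}.

Section Semantics.
Variables (L : language) (M : structure L).

Definition env_cons n (a : M) (e : 'I_n -> M) : 'I_n.+1 -> M :=
  fun i => if unlift ord0 i is Some j then e j else a.

Fixpoint eval n (e : 'I_n -> M) (t : term L n) : M :=
  match t with
  | Var i => e i
  | App f ts => fun_interp (fun i => eval e (ts i))
  end.

Fixpoint sat n (e : 'I_n -> M) (phi : formula L n) : Prop :=
  match phi with
  | Bot => False
  | Eq t u => eval e t = eval e u
  | Rel R ts => rel_interp (fun i => eval e (ts i))
  | And p q => sat e p /\ sat e q
  | Or p q => sat e p \/ sat e q
  | Imp p q => sat e p -> sat e q
  | All p => forall a, sat (env_cons a e) p
  | Ex p => exists a, sat (env_cons a e) p
  end.

Definition holds (phi : sentence L) : Prop :=
  forall e : 'I_0 -> M, sat e phi.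

Definition models (T : set (sentence L)) : Prop :=
  forall phi, T phi -> holds phi.

End Semantics.

Section Theories.
Variables (L : language) (T : set (sentence L)).

Definition satisfiable : Prop := exists M : structure L, models M T.

Definition entails (phi : sentence L) : Prop :=
  forall M : structure L, models M T -> holds M phi.

Definition complete_theory : Prop :=
  satisfiable /\ forall phi : sentence L, entails phi \/ entails (Not phi).

Definition equivalent_modulo n (phi psi : formula L n) : Prop :=
  forall M : structure L, models M T ->
  forall e : 'I_n -> M, sat e phi <-> sat e psi.

Definition eliminates_quantifiers : Prop :=
  forall n (phi : formula L n),
  exists2 psi : formula L n, quantifier_free psi & equivalent_modulo phi psi.

End Theories.

Section TK.
Variable K : fieldType.

Variant LK_fun := Zero | Add | Scale of K.

Definition LK_fun_arity (f : LK_fun) : nat :=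
  match f with Zero => 0 | Add => 2 | Scale _ => 1 end.

(* The relation symbol [n : nat] is the unary predicate X^n. *)
Definition LK : language := Language LK_fun_arity (fun _ : nat => 1).

Section TermsAndFormulas.
Variable n : nat.
Implicit Types (t u : term LK n).

Definition tzero : term LK n :=
  @App LK n Zero (fun i => match notF (ltn_ord i) with end).
Definition tadd t u : term LK n :=
  @App LK n Add (fun i => if i == ord0 then t else u).
Definition tscale (lam : K) t : term LK n := @App LK n (Scale lam) (fun _ => t).
Definition inX (k : nat) t : formula LK n := @Rel LK n k (fun _ => t).
Definition X t : formula LK n := inX 1 t.
Definition Xnz t : formula LK n := And (X t) (Not (Eq t tzero)).
Definition par t u : formula LK n := X (tadd t u).

(* The t_i are nonzero elements of pairwise distinct axes. *)
Definition distinct_axes k (t : 'I_k -> term LK n) : formula LK n :=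
  And (\big[@And LK n/Top]_(i < k) Xnz (t i))
      (\big[@And LK n/Top]_(i < k)
        \big[@And LK n/Top]_(j < k | i != j) Not (par (t i) (t j))).

End TermsAndFormulas.

Arguments tzero {n}.

Definition Xn_def (k : nat) : sentence LK :=
  let x : term LK (k + 1) := Var (rshift k ord0) in
  let y (i : 'I_k) : term LK (k + 1) := Var (lshift 1 i) in
  All (Iff (inX k v0)
           (Exs k (And (\big[@And LK (k + 1)/Top]_(i < k) X (y i))
                       (Eq x (\big[@tadd (k + 1)/tzero]_(i < k) y i))))).

Definition at_least_axes (k : nat) : sentence LK :=
  Exs k (distinct_axes (fun i : 'I_k => Var (lshift 0 i))).

Definition axes_no_relation k (lam : 'I_k -> K) : sentence LK :=
  let a (i : 'I_k) : term LK (k + 0) := Var (lshift 0 i) in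
  Alls k (Imp (distinct_axes a)
    (Not (Eq (\big[@tadd (k + 0)/tzero]_(i < k) tscale (lam i) (a i)) tzero))).

Local Open Scope ring_scope.

Inductive TK : set (sentence LK) :=
| vs_addA : TK (All (All (All
    (Eq (tadd v2 (tadd v1 v0)) (tadd (tadd v2 v1) v0)))))
| vs_addC : TK (All (All (Eq (tadd v1 v0) (tadd v0 v1))))
| vs_add0 : TK (All (Eq (tadd tzero v0) v0))
| vs_addN : TK (All (Ex (Eq (tadd v1 v0) tzero)))
| vs_scaleA (lam mu : K) :
    TK (All (Eq (tscale lam (tscale mu v0)) (tscale (lam * mu) v0)))
| vs_scale1 : TK (All (Eq (tscale 1 v0) v0))
| vs_scaleDr (lam : K) : TK (All (All
    (Eq (tscale lam (tadd v1 v0)) (tadd (tscale lam v1) (tscale lam v0)))))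
| vs_scaleDl (lam mu : K) : TK (All
    (Eq (tscale (lam + mu) v0) (tadd (tscale lam v0) (tscale mu v0))))
| X_scale (lam : K) : TK (All (Imp (X v0) (X (tscale lam v0))))
| X_power (k : nat) : TK (Xn_def k)
| par_refl : TK (All (Imp (Xnz v0) (par v0 v0)))
| par_sym : TK (All (All
    (Imp (And (Xnz v1) (Xnz v0)) (Imp (par v1 v0) (par v0 v1)))))
| par_trans : TK (All (All (All
    (Imp (And (Xnz v2) (And (Xnz v1) (Xnz v0)))
         (Imp (And (par v2 v1) (par v1 v0)) (par v2 v0))))))
| infinitely_many_axes (k : nat) : TK (at_least_axes k)
| axes_independent (k : nat) (lam : 'I_k.+1 -> K) of (exists i, lam i != 0) :
    TK (axes_no_relation lam).

End TK.

Arguments TK : clear implicits.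

(* Main.v *)
Require Import Defs.
From HB Require Import structures.
From mathcomp Require Import all_boot all_algebra.
From mathcomp Require Import boolp classical_sets cardinality.

(** Why the theorem is true.  In a model every axis is a subspace and the sum of
    the axes is direct, so a vector of some X^n has a [component] on each axis;
    the least such n is its rank, the number of axes on which the component is
    nonzero.  Vectors outside the span of X have infinite rank.  Since equality
    is X^0, everything that a quantifier-free formula can say of a tuple is a
    statement about the ranks of its linear combinations.

    Instead of saturated models, the proof runs a back-and-forth argument with
    finite approximations: two tuples, in possibly different models, [agree] on
    a finite list of pairs (l, k) if for each of them the combinations with
    coefficients l are both in X^k or both outside it.  The main step
    [extends_all] says that for each finite list S in n + 1 variables there is a
    finite list S' in n variables such that, if a and b agree on S', then each x
    has a counterpart y for which (x, a) and (y, b) agree on S.  By induction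
    the truth of any formula depends on finitely many of these conditions
    ([formula_determined]), so it is equivalent to a Boolean combination of them
    ([qf_definable]).  A sentence then has the same truth value in all models,
    and there is one: the polynomials, the axes being the lines spanned by the
    powers of the variable.

    For the main step, a vector x at finite distance from one of the relevant
    combinations of a differs from it by a sum of boundedly many elements of X,
    which are added one at a time; any other x is imitated by a vector of large
    finite rank ([far_point]).  There remains x in X.  The ranks of the
    translates c - x of finitely many vectors c of bounded rank depend only on
    the ranks of the c and on which of the components of the c on the axis of x
    are zero, or equal, or equal to x ([rank_translate]).  So an axis of the
    second model must be found with the same pattern of coincidences
    ([same_pattern]).  This is where K being infinite matters, in two ways.  The
    number of axes on which at least one member of a family is nonzero is the
    largest rank of a combination of the family, and is attained with
    coefficients from a finite set given in advance ([generic_combination]);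
    these numbers determine, by Moebius inversion, how many axes have each
    pattern ([count_pattern]).  And once the axis is found, it contains a vector
    y other than the finitely many components to be avoided. *)

Set Implicit Arguments.
Unset Strict Implicit.
Unset Printing Implicit Defensive.

Import GRing.Theory.
Local Open Scope ring_scope.

(** * Vector spaces with independent axes *)

Section Axes.
Variables (K : fieldType) (V : lmodType K) (X : pred V).

Definition on_axis (e y : V) : bool := X y && X (e + y).

(** Finitely many distinct axes, each given by a nonzero representative. *)
Definition frame (E : seq V) : Prop :=
  [/\ uniq E, {in E, forall e, X e && (e != 0)} &
      {in E &, forall e f, on_axis e f -> e = f}].

Lemma frame_nth E (i j : 'I_(size E)) : frame E -> X (nth 0 E i + nth 0 E j) -> i = j.
Proof.
move=> [uE EX Einj] Xij; have ijE : nth 0 E i = nth 0 E j.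
  apply: Einj; rewrite ?mem_nth // /on_axis Xij andbT.
  by case/andP: (EX _ (mem_nth 0 (ltn_ord j))).
apply: val_inj; apply/eqP.
by rewrite -(nth_uniq 0 (ltn_ord i) (ltn_ord j) uE) ijE.
Qed.
End Axes.

(** The independence of the axes is stated for sums without coefficients: the
    axes being closed under scaling, coefficients can be absorbed into the
    representatives.  In [parallel_trans] the end points may be zero, where the
    conclusion is immediate; this avoids case distinctions later. *)
Record axialSpace (K : fieldType) := AxialSpace {
  axial_mod :> lmodType K;
  onX : pred axial_mod;
  onX0 : onX 0;
  onXZ : forall (a : K) x, onX x -> onX (a *: x);
  parallel_trans : forall x y z, y != 0 -> onX x -> onX y -> onX z ->
    onX (x + y) -> onX (y + z) -> onX (x + z);
  frame_free : forall E, frame onX E -> \sum_(e <- E) e = 0 -> E = [::];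
  frame_large : forall k, exists2 E, frame onX E & size E = k
}.

Lemma sum_nth (V : zmodType) (s : seq V) k : (size s <= k)%N ->
  \sum_(i < k) nth 0 s i = \sum_(x <- s) x.
Proof.
move=> sk; rewrite -(big_mkord xpredT (fun i => nth 0 s i)) [RHS](big_nth 0).
rewrite (big_cat_nat (n := size s)) //= [X in _ + X]big_nat_cond.
rewrite [X in _ + X]big1 ?addr0 // => i /andP[/andP[si _] _].
by rewrite nth_default.
Qed.

Section AxialTheory.
Variables (K : fieldType) (V : axialSpace K).
Local Notation X := (@onX K V).
Local Notation axis := (on_axis X).
Implicit Types (e f x y v : V) (E ys : seq V).

Lemma onXN x : X x -> X (- x).
Proof. by move=> Xx; rewrite -scaleN1r onXZ. Qed.

Lemma axis0 e : X e -> axis e 0.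
Proof. by move=> Xe; rewrite /on_axis onX0 addr0. Qed.

Lemma axis_refl e : X e -> axis e e.
Proof. by move=> Xe; rewrite /on_axis Xe -mulr2n -scaler_nat onXZ. Qed.

Lemma axis_sym e f : X e -> axis e f -> axis f e.
Proof. by move=> Xe /andP[Xf Xef]; rewrite /on_axis Xe addrC. Qed.

Lemma axis_trans e f y : X e -> f != 0 -> axis e f -> axis f y -> axis e y.
Proof.
move=> Xe f0 /andP[Xf Xef] /andP[Xy Xfy]; rewrite /on_axis Xy.
exact: parallel_trans Xe Xf Xy Xef Xfy.
Qed.

Lemma eq_axis e f : X e -> e != 0 -> f != 0 -> axis e f -> axis e =1 axis f.
Proof.
move=> Xe e0 f0 ef y; have Xf : X f by case/andP: ef.
apply/idP/idP; last exact: (axis_trans Xe f0 ef).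
exact: (axis_trans Xf e0 (axis_sym Xe ef)).
Qed.

Lemma axisZ e y a : X e -> axis e y -> axis e (a *: y).
Proof.
move=> Xe ey; have [->|y0] := eqVneq y 0; first by rewrite scaler0 axis0.
have Xy : X y by case/andP: ey.
apply: (axis_trans Xe y0 ey).
by rewrite /on_axis onXZ // -{1}[y]scale1r -scalerDl onXZ.
Qed.

Lemma axisN e y : X e -> axis e y -> axis e (- y).
Proof. by move=> Xe ey; rewrite -scaleN1r axisZ. Qed.

(** Follow the chain e, - z, y + z: the sum of the last two is y, which is in X,
    so y + z is parallel to - z, which is parallel to e. *)
Lemma axisD e y z : X e -> e != 0 -> axis e y -> axis e z -> axis e (y + z).
Proof.
move=> Xe e0 ey ez; have [->|z0] := eqVneq z 0; first by rewrite addr0.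
have ye : axis y e by apply: axis_sym.
have Xy : X y by case/andP: ey.
have /andP[Xz Xyz] : axis y z by apply: axis_trans ye ez.
apply: (@axis_trans _ (- z)) => //; rewrite ?oppr_eq0 ?axisN //.
by rewrite /on_axis Xyz addrC addrK.
Qed.

Lemma axis_sum e ys : X e -> e != 0 -> axis e (\sum_(y <- ys | axis e y) y).
Proof.
move=> Xe e0; elim/big_rec: _ => [|y z ey ez]; first exact: axis0.
exact: axisD.
Qed.

Lemma frame1 e : X e -> e != 0 -> frame X [:: e].
Proof.
move=> Xe e0; split=> // [f|f g]; rewrite !inE; first by move/eqP->; rewrite Xe.
by move=> /eqP-> /eqP->.
Qed.

Lemma frame_cons e E : X e -> e != 0 -> frame X E ->
  ~~ has (axis^~ e) E -> frame X (e :: E).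
Proof.
move=> Xe e0 [uE EX Einj] nE; have eE : e \notin E.
  by apply/negP => eE; case/negP: nE; apply/hasP; exists e => //; apply: axis_refl.
split=> /=; first by rewrite eE.
  by move=> f; rewrite inE => /predU1P[->|/EX//]; rewrite Xe.
move=> f g; rewrite !inE => /predU1P[->|fE] /predU1P[->|gE] //; last exact: Einj.
  move=> eg; case/negP: nE; apply/hasP; exists g => //.
  by apply: axis_sym.
by move=> fe; case/negP: nE; apply/hasP; exists f.
Qed.

Lemma frame_extend E0 ys : frame X E0 -> all X ys ->
  exists E, [/\ frame X (E ++ E0), (size E <= size ys)%N &
    {in ys, forall y, y != 0 -> has (axis^~ y) (E ++ E0)}].
Proof.
move=> fE0; elim: ys => [_|y ys IH /= /andP[Xy /IH[E [fE sE cE]]]].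
  by exists [::]; split.
have [/orP yE|] := boolP ((y == 0) || has (axis^~ y) (E ++ E0)).
  exists E; split=> //; first exact: leqW.
  move=> z; rewrite inE => /predU1P[->|/cE//] z0; case: yE => //.
  by rewrite (negPf z0).
rewrite negb_or => /andP[y0 nE]; exists (y :: E); split=> //.
  exact: frame_cons.
move=> z; rewrite inE => /predU1P[->|/cE Ez] z0 /=; first by rewrite axis_refl.
by rewrite Ez // orbT.
Qed.

(** No vector represents two axes of a frame, so choosing a representative in
    [ys] for each member of the frame is injective. *)
Lemma frame_size E ys : frame X E ->
  {in E, forall e, exists2 y, y \in ys & (y != 0) && axis e y} ->
  (size E <= size ys)%N.
Proof.
move=> [uE EX Einj] H.
have /choice[g gP] : forall e, exists y,
    e \in E -> [/\ y \in ys, y != 0 & axis e y].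
  move=> e; case: (boolP (e \in E)) => [/H[y yys /andP[y0 ey]]|_]; last by exists 0.
  by exists y.
rewrite -(size_map g); apply: uniq_leq_size; last first.
  by move=> _ /mapP[e eE ->]; case: (gP e eE).
rewrite map_inj_in_uniq // => e f eE fE efg.
have [_ ge0 ege] := gP e eE; have [_ gf0 fgf] := gP f fE.
have /andP[Xe e0] := EX e eE; have /andP[Xf f0] := EX f fE.
apply: Einj => //; apply: (axis_trans Xe ge0 ege).
by rewrite efg; apply: axis_sym.
Qed.

Lemma frame_single E y : frame X E -> X y -> has (axis^~ y) E -> y != 0 ->
  \sum_(e <- E | axis e y) y = y.
Proof.
move=> [uE EX Einj] Xy /hasP[e eE ey] y0.
have /andP[Xe e0] := EX e eE.
rewrite (big_rem e) //= ey big_seq_cond big1 ?addr0 // => f /andP[].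
rewrite mem_rem_uniq // inE => /andP[fe fE] fy.
case/negP: fe; apply/eqP; apply: Einj => //.
have /andP[Xf f0] := EX f fE.
by apply: (axis_trans Xf y0 fy); apply: axis_sym.
Qed.

(** The sum of the axes is direct.  Grouping a vanishing sum of elements of X by
    axis gives one vector per axis; the nonzero ones form a frame of sum zero,
    so there are none. *)
Lemma axis_sum0 e ys : X e -> e != 0 -> all X ys ->
  \sum_(y <- ys) y = 0 -> \sum_(y <- ys | axis e y) y = 0.
Proof.
move=> Xe e0 Xys ys0.
have [E [fE _ cE]] := frame_extend (frame1 Xe e0) Xys.
set F := E ++ [:: e] in fE cE.
have eF : e \in F by rewrite mem_cat inE eqxx orbT.
pose g f := \sum_(y <- ys | axis f y) y.
have [uF FX Finj] := fE.
have gF f : f \in F -> axis f (g f).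
  by move=> /FX/andP[Xf f0]; apply: axis_sum.
(* each nonzero y in ys is on exactly one axis of F, so nothing is lost *)
have gs : \sum_(f <- [seq g f | f <- F & g f != 0]) f = 0.
  rewrite big_map big_filter -[RHS]ys0 big_mkcond /=.
  under eq_bigr do rewrite if_neg (fun_if (fun b => b)).
  transitivity (\sum_(f <- F) g f).
    by apply: eq_bigr => f _; case: eqP => // ->.
  rewrite /g (exchange_big_dep xpredT) //=; rewrite !big_seq; apply: eq_bigr => y yys.
  have [->|y0] := eqVneq y 0; first by rewrite big1.
  by apply: frame_single => //; [apply: (allP Xys)|apply: cE].
suff fg : frame X [seq g f | f <- F & g f != 0].
  have := frame_free fg gs => /(congr1 size)/eqP.
  rewrite size_map size_filter /= -leqn0 leqNgt -has_count => /hasPn/(_ e eF).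
  by move/negPn/eqP.
(* the nonzero sums still lie on distinct axes *)
have ginj f f' : f \in F -> f' \in F -> g f != 0 -> axis (g f) (g f') ->
    g f' != 0 -> f = f'.
  move=> fF fF' gf0 gg gf0'; apply: Finj => //.
  have /andP[Xf f0] := FX f fF; have /andP[Xf' f0'] := FX f' fF'.
  apply: (axis_trans Xf gf0 (gF f fF)); apply: (axis_trans _ gf0' gg).
    by case/andP: (gF f fF).
  by apply: axis_sym => //; apply: gF.
split.
- rewrite map_inj_in_uniq ?filter_uniq // => f f'.
  rewrite !mem_filter => /andP[gf0 fF] /andP[gf0' fF'] ff'.
  apply: ginj => //; rewrite -ff' axis_refl //; by case/andP: (gF f fF).
- move=> y /mapP[f]; rewrite mem_filter => /andP[gf0 fF] ->.
  by rewrite gf0 andbT; case/andP: (gF f fF).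
move=> y z /mapP[f]; rewrite mem_filter => /andP[gf0 fF] ->.
move=> /mapP[f']; rewrite mem_filter => /andP[gf0' fF'] -> gg.
by rewrite (ginj f f').
Qed.

Definition inXn k v :=
  exists ys, [/\ (size ys <= k)%N, all X ys & v = \sum_(y <- ys) y].

(** Vectors outside the span of X receive the empty decomposition, hence only
    zero components. *)
Definition decomposition v : seq V :=
  xget [::] [set ys | all X ys /\ v = \sum_(y <- ys) y].

Definition component e v : V := \sum_(y <- decomposition v | axis e y) y.

Lemma decompositionP k v : inXn k v ->
  all X (decomposition v) /\ v = \sum_(y <- decomposition v) y.
Proof.
case=> ys [_ Xys vE]; rewrite /decomposition; case: xgetP => [zs _ //|/(_ ys)[]].
by [].
Qed.

Lemma componentE e ys : X e -> e != 0 -> all X ys ->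
  component e (\sum_(y <- ys) y) = \sum_(y <- ys | axis e y) y.
Proof.
move=> Xe e0 Xys; set v := \sum_(y <- ys) y.
have [|Xd vE] := @decompositionP (size ys) v; first by exists ys.
have axN y : axis e (- y) = axis e y.
  by apply/idP/idP => /axisN - /(_ Xe); rewrite ?opprK.
have := @axis_sum0 e (decomposition v ++ [seq - y | y <- ys]) Xe e0.
rewrite !big_cat !big_map all_cat Xd /= -vE.
under [X in _ -> _ -> _ + X = _]eq_bigl do rewrite axN.
rewrite !sumrN subrr => H; apply/eqP; rewrite -subr_eq0 H //.
by rewrite all_map; apply: sub_all Xys => y /= /onXN.
Qed.

Variable e : V.
Hypotheses (Xe : X e) (e0 : e != 0).

Lemma component_axis v : axis e (component e v).
Proof. exact: axis_sum. Qed.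

Lemma component0 : component e 0 = 0.
Proof. by have := componentE Xe e0 (isT : all X [::]); rewrite !big_nil. Qed.

Lemma component_onX x : X x -> component e x = if axis e x then x else 0.
Proof.
move=> Xx; have := @componentE e [:: x] Xe e0.
by rewrite /= Xx !big_cons !big_nil addr0 => ->//; case: ifP; rewrite ?addr0.
Qed.

Lemma componentD k l u v : inXn k u -> inXn l v ->
  component e (u + v) = component e u + component e v.
Proof.
move=> [ys [_ Xys ->]] [zs [_ Xzs ->]].
by rewrite -big_cat !componentE // ?all_cat ?Xys // big_cat.
Qed.

Lemma componentZ k a v : inXn k v -> component e (a *: v) = a *: component e v.
Proof.
have [->|a0] := eqVneq a 0; first by rewrite !scale0r component0.
move=> [ys [_ Xys ->]]; rewrite scaler_sumr.
have := @componentE e [seq a *: y | y <- ys] Xe e0.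
rewrite !big_map componentE // => ->.
  rewrite scaler_sumr; apply: eq_bigl => y; apply/idP/idP; last exact: axisZ.
  by move/(axisZ a^-1 Xe); rewrite scalerA mulVf // scale1r.
by rewrite all_map; apply: sub_all Xys => y /= /onXZ.
Qed.

End AxialTheory.

(** * Rank of a vector *)

Section Rank.
Variables (K : fieldType) (V : axialSpace K).
Local Notation X := (@onX K V).
Local Notation axis := (on_axis X).
Implicit Types (e f x y v : V) (E ys : seq V).

Lemma inXn_le j k v : (j <= k)%N -> inXn j v -> inXn k v.
Proof. by move=> jk [ys [ysj Xys vE]]; exists ys; split=> //; apply: leq_trans jk. Qed.

Lemma inXn0 k : inXn k (0 : V).
Proof. by exists [::]; rewrite big_nil. Qed.

Lemma inXn1 x : inXn 1 x <-> X x.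
Proof.
split=> [[[|y [|z ys]] [//= _ Xy ->]]|Xx].
- by rewrite big_nil onX0.
- by rewrite big_seq1; case/andP: Xy.
by exists [:: x]; rewrite /= Xx big_seq1.
Qed.

Lemma inXnD j k u v : inXn j u -> inXn k v -> inXn (j + k) (u + v).
Proof.
move=> [ys [ysj Xys ->]] [zs [zsk Xzs ->]]; exists (ys ++ zs).
by rewrite size_cat leq_add // all_cat Xys Xzs big_cat.
Qed.

Lemma inXnZ k a v : inXn k v -> inXn k (a *: v).
Proof.
move=> [ys [ysk Xys ->]]; exists [seq a *: y | y <- ys].
rewrite size_map ysk big_map scaler_sumr all_map; split=> //.
by apply: sub_all Xys => y /= /onXZ.
Qed.

Lemma inXnZ_iff k a v : a != 0 -> inXn k (a *: v) <-> inXn k v.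
Proof.
move=> a0; split=> [/(inXnZ a^-1)|]; last exact: inXnZ.
by rewrite scalerA mulVf // scale1r.
Qed.

Lemma inXnB j k u v : inXn j u -> inXn k v -> inXn (j + k) (u - v).
Proof. by move=> ju kv; rewrite -scaleN1r; apply: inXnD => //; apply: inXnZ. Qed.

Lemma inXn_sum (I : eqType) (s : seq I) (P : pred I) k (v : I -> V) :
  {in s, forall i, P i -> inXn k (v i)} ->
  inXn (count P s * k) (\sum_(i <- s | P i) v i).
Proof.
elim: s => [|i s IH] H; first by rewrite big_nil; apply: inXn0.
have {}IH := IH (fun j js => H j (mem_behead (s := i :: s) js)).
rewrite big_cons /=; case: ifP => //= Pi; rewrite mulSn; apply: inXnD => //.
by apply: H; rewrite ?mem_head.
Qed.

Lemma inXn_sum_any (I : eqType) (s : seq I) (P : pred I) (v : I -> V) :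
  {in s, forall i, P i -> exists k, inXn k (v i)} ->
  exists k, inXn k (\sum_(i <- s | P i) v i).
Proof.
elim: s => [|i s IH] H; first by exists 0%N; rewrite big_nil; apply: inXn0.
have [k sk] := IH (fun j js => H j (mem_behead (s := i :: s) js)).
rewrite big_cons; case: ifP => [Pi|_]; last by exists k.
have [||l il] := H i; rewrite ?mem_head //.
by exists (l + k)%N; apply: inXnD.
Qed.

Lemma component_sum e (I : eqType) (s : seq I) (P : pred I) (v : I -> V) :
  X e -> e != 0 -> {in s, forall i, P i -> exists k, inXn k (v i)} ->
  component e (\sum_(i <- s | P i) v i) = \sum_(i <- s | P i) component e (v i).
Proof.
move=> Xe e0; elim: s => [|i s IH] H; first by rewrite !big_nil component0.
have Hs j js := H j (mem_behead (s := i :: s) js).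
rewrite !big_cons -IH //; case: ifP => // Pi.
have [l il] := H i (mem_head _ _) Pi; have [k sk] := inXn_sum_any Hs.
exact: componentD il sk.
Qed.

Lemma component_eq e f v : X e -> e != 0 -> f != 0 -> axis e f ->
  component e v = component f v.
Proof. by move=> Xe e0 f0 ef; apply: eq_bigl; apply: eq_axis. Qed.

(** For v in the span of X: every nonzero component of v is on an axis of E. *)
Definition spanned E v := v = \sum_(e <- E) component e v.

(** The rank counts the nonzero components: a component of a sum is nonzero only
    if one of the summands is on its axis, and a summand is on one axis only. *)
Lemma spanned_rank E k j v : frame X E -> inXn k v -> spanned E v ->
  inXn j v <-> (count (fun e => component e v != 0%R) E <= j)%N.
Proof.
move=> fE kv vE; have [uE EX Einj] := fE; split=> [[ys [sj Xys vys]]|cj].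
  apply: leq_trans sj; rewrite -size_filter; apply: (@frame_size _ V).
    split; first exact: filter_uniq.
      by move=> e; rewrite mem_filter => /andP[_ /EX].
    by move=> e f; rewrite !mem_filter => /andP[_ eE] /andP[_ fE']; apply: Einj.
  move=> e; rewrite mem_filter => /andP[ev eE].
  have /andP[Xe e0] := EX e eE; apply: contrapT => H; case/eqP: ev.
  rewrite vys componentE // big_seq_cond big1 // => y /andP[yys ey].
  by apply: contrapT => /eqP y0; apply: H; exists y; rewrite ?y0.
exists [seq component e v | e <- E & component e v != 0].
rewrite size_map size_filter cj all_map; split=> //.
  apply/allP => e; rewrite mem_filter => /andP[_ /EX/andP[Xe e0]] /=.
  by have /andP[] := component_axis Xe e0 v.
rewrite big_map big_filter {1}vE [RHS]big_mkcond; apply: eq_bigr => e _.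
by case: eqP.
Qed.

Lemma spanned_sum E (I : eqType) (s : seq I) (P : pred I) (v : I -> V) :
  frame X E ->
  {in s, forall i, P i -> exists k, inXn k (v i)} ->
  {in s, forall i, P i -> spanned E (v i)} ->
  spanned E (\sum_(i <- s | P i) v i).
Proof.
move=> [_ EX _] sX sE; rewrite /spanned.
under [RHS]eq_big_seq => e /EX/andP[Xe e0] do rewrite component_sum //.
rewrite exchange_big /= big_seq_cond [RHS]big_seq_cond.
by apply: eq_bigr => i /andP[/sE sEi /sEi].
Qed.

Lemma spanned_onX E x : frame X E -> X x -> has (axis^~ x) E -> spanned E x.
Proof.
move=> fE Xx Ex; have [_ EX _] := fE; rewrite /spanned.
under eq_big_seq => e /EX/andP[Xe e0] do rewrite component_onX //.
have [->|x0] := eqVneq x 0; first by rewrite big1 // => e _; case: ifP.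
by rewrite -big_mkcond frame_single.
Qed.

(** The bound on the size of E depends on the ranks and on the number of the
    vectors only, which makes it the same in all models. *)
Lemma spanning_frame E0 k (vs : seq V) : frame X E0 ->
  {in vs, forall v, inXn k v} ->
  exists E, [/\ frame X (E ++ E0), (size E <= size vs * k)%N &
    {in vs, forall v, spanned (E ++ E0) v}].
Proof.
move=> fE0 vsk.
have [ys [sys Xys ysP]] : exists ys, [/\ (size ys <= size vs * k)%N, all X ys &
    {in vs, forall v, exists2 zs, {subset zs <= ys} & v = \sum_(z <- zs) z}].
  elim: vs vsk => [_|v vs IH vsk]; first by exists [::].
  have {}[w ws|ys [sys Xys ysP]] := IH; first by apply: vsk; rewrite inE ws orbT.
  have [zs [szs Xzs vE]] := vsk v (mem_head _ _).
  exists (zs ++ ys); rewrite size_cat mulSn leq_add // all_cat Xzs Xys.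
  split=> // w; rewrite inE => /predU1P[->|/ysP[us us_ys wE]].
    by exists zs => // z; rewrite mem_cat => ->.
  by exists us => // u /us_ys; rewrite mem_cat => ->; rewrite orbT.
have [E [fE sE cE]] := frame_extend fE0 Xys.
exists E; split=> //; first exact: leq_trans sys.
move=> v /ysP[zs zsys ->]; apply: spanned_sum => // z /zsys zys _.
  by exists 1%N; apply/inXn1; apply: (allP Xys).
have Xz := allP Xys z zys.
have [->|z0] := eqVneq z 0; last by apply: spanned_onX => //; apply: cE.
rewrite /spanned big_seq big1 // => e /=; case: fE => _ EX _ /EX/andP[Xe e0].
by rewrite component0.
Qed.

(** Subtracting x changes only the component on the axis of x, from [component x v]
    to [component x v - x]; r counts the nonzero components on the other axes. *)
Lemma rank_translate x k v : X x -> x != 0 -> inXn k v -> exists r, forall j,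
  (inXn j v <-> (r + (component x v != 0%R) <= j)%N) /\
  (inXn j (v - x) <-> (r + (component x v != x) <= j)%N).
Proof.
move=> Xx x0 kv.
have [|E [fE _ vE]] := @spanning_frame [:: x] k [:: v] (frame1 Xx x0).
  by move=> w; rewrite inE => /eqP->.
have {}vE := vE v (mem_head _ _).
have [uE EX Einj] := fE.
have xE : x \in E ++ [:: x] by rewrite mem_cat inE eqxx orbT.
have xX : inXn 1 x by apply/inXn1.
have xv : spanned (E ++ [:: x]) (v - x).
  have xS : spanned (E ++ [:: x]) x.
    by apply: spanned_onX => //; apply/hasP; exists x => //; apply: axis_refl.
  rewrite /spanned [LHS](congr2 (fun a b => a - b) vE xS) -sumrB.
  apply: eq_big_seq => e /EX/andP[Xe e0].
  rewrite -scaleN1r (componentD Xe e0 kv (inXnZ _ xX)).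
  by rewrite (componentZ Xe e0 _ xX) scaleN1r.
exists (count (fun e => component e v != 0) E) => j; split.
  by rewrite (spanned_rank _ fE kv vE) count_cat /= addn0.
rewrite (spanned_rank _ fE (inXnB kv xX) xv) count_cat /= addn0.
have compB e : X e -> e != 0 ->
    component e (v - x) = component e v - component e x.
  move=> Xe e0; rewrite -scaleN1r (componentD Xe e0 kv (inXnZ _ xX)).
  by rewrite (componentZ Xe e0 _ xX) scaleN1r.
rewrite compB // (component_onX Xx x0 Xx) axis_refl // subr_eq0.
suff -> : count (fun e => component e (v - x) != 0) E =
          count (fun e => component e v != 0) E by [].
apply: eq_in_count => e eE.
have eEx : e \in E ++ [:: x] by rewrite mem_cat eE.
have /andP[Xe e0] := EX e eEx.
rewrite compB // (component_onX Xe e0 Xx) ifF ?subr0 //; apply/negP => ex.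
have exx := Einj _ _ eEx xE ex.
by move: uE; rewrite cat_uniq /= orbF -exx eE /= andbF.
Qed.

Lemma off_frame E : frame X E -> exists y, [/\ X y, y != 0 & ~~ has (axis^~ y) E].
Proof.
move=> fE; have [E' fE' sE'] := frame_large V (size E).+1.
have [_ EX' _] := fE'; have [_ EX _] := fE.
apply: contrapT => H; suff: (size E' <= size E)%N by rewrite sE' ltnn.
apply: (frame_size fE') => y yE'; have /andP[Xy y0] := EX' y yE'.
have /hasP[e eE ey] : has (axis^~ y) E.
  by apply: contrapT => /negP nE; apply: H; exists y.
have /andP[Xe e0] := EX e eE.
by exists e => //; rewrite e0 axis_sym.
Qed.

Lemma component_off E y v : frame X E -> X y -> y != 0 ->
  ~~ has (axis^~ y) E -> spanned E v -> component y v = 0.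
Proof.
move=> [_ EX _] Xy y0 nE ->.
have Xc e : e \in E -> X (component e v).
  by move=> /EX/andP[Xe e0]; have /andP[] := component_axis Xe e0 v.
rewrite component_sum //; last by move=> e eE _; exists 1%N; apply/inXn1/Xc.
rewrite big_seq big1 // => e eE; have /andP[Xe e0] := EX e eE.
rewrite component_onX ?Xc //; case: ifP => // yc.
apply: contrapT => /eqP c0; case/hasP: nE; exists e => //.
apply: (axis_trans Xe c0 (component_axis Xe e0 v)).
exact: axis_sym.
Qed.
End Rank.

(** * Counting patterns from their up-sets *)

Section Patterns.
Variable P : finType.
Implicit Types A B : seq {set P}.

Lemma count_sum_mem (T : finType) (a : pred T) (s : seq T) :
  count a s = (\sum_(x | a x) count_mem x s)%N.
Proof.
elim: s => [|y s IH] /=; first by rewrite big1.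
rewrite big_split /= -IH; congr addn.
under eq_bigr do rewrite eq_sym.
case: (boolP (a y)) => ay.
  rewrite (bigD1 y) //= eqxx big1 // => z /andP[_ /negPf]; by rewrite eq_sym => ->.
by rewrite big1 // => z az; case: eqP => // zy; rewrite -zy az in ay.
Qed.

(** Moebius inversion along inclusion: the sets containing G are counted by the
    hypothesis, and those strictly containing G by induction.  The full set is
    excluded because the hypothesis gives no information about its
    multiplicity. *)
Lemma count_pattern A B :
  (forall F : {set P}, count (fun Z : {set P} => ~~ (F \subset Z)) A =
                       count (fun Z : {set P} => ~~ (F \subset Z)) B) ->
  forall G, G != [set: P] -> count_mem G A = count_mem G B.
Proof.
move=> AB G; have [n] := ubnP #|~: G|; elim: n G => // n IH G sG GT.
pose above (Z : {set P}) := (G \proper Z) && (Z != [set: P]).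
have splitG C : (count_mem G C + count above C
    + count (fun Z : {set P} => ~~ (G \subset Z)) C
    = count (fun Z : {set P} => ~~ ([set: P] \subset Z)) C)%N.
  have noboth (a b : pred {set P}) : (forall Z, a Z -> ~~ b Z) ->
      (count a C + count b C)%N = count (predU a b) C.
    move=> ab; rewrite -count_predUI (_ : count (predI a b) C = 0%N) ?addn0 //.
    apply/eqP; rewrite -leqn0 leqNgt -has_count.
    by apply/hasP => -[Z _ /andP[/ab/negP nb /nb]].
  rewrite noboth => [|Z /eqP->]; last by rewrite /above fintype.properxx.
  rewrite noboth => [|Z /=]; last first.
    by move=> /orP[/eqP->|/andP[/fintype.proper_sub->]]; rewrite ?subxx.
  apply: eq_count => Z /=; rewrite finset.subTset /above.
  have [-> | ZT] := eqVneq Z [set: P].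
    by rewrite finset.subsetT andbF eq_sym (negPf GT).
  rewrite andbT finset.properEneq [G == Z]eq_sym; case: (eqVneq Z G) => //= ZG.
  by rewrite orbN.
have aboveAB : count above A = count above B.
  rewrite !count_sum_mem; apply: eq_bigr => H /andP[GH HT]; apply: IH => //.
  apply: (@leq_trans #|~: G|) => //; apply: fintype.proper_card.
  by rewrite fintype.properE !finset.setCS -fintype.properE.
have := splitG A; rewrite !AB -(splitG B) aboveAB => /eqP.
by rewrite !eqn_add2r => /eqP.
Qed.
End Patterns.

(** * Agreement of tuples on finitely many ranks *)

Section Agreement.
Variable K : fieldType.

Definition lincomb (V : lmodType K) (I : finType) (l : {ffun I -> K}) (a : I -> V) : V :=
  \sum_i l i *: a i.

Definition agree (I : finType) (S : seq ({ffun I -> K} * nat)) (V W : axialSpace K)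
    (a : I -> V) (b : I -> W) : Prop :=
  {in S, forall p, inXn p.2 (lincomb p.1 a) <-> inXn p.2 (lincomb p.1 b)}.

Lemma agree_sym (I : finType) (S : seq ({ffun I -> K} * nat)) (V W : axialSpace K)
    (a : I -> V) (b : I -> W) : agree S a b -> agree S b a.
Proof. by move=> H p pS; split=> /(H p pS). Qed.

Lemma agree_sub (I : finType) (S S' : seq ({ffun I -> K} * nat)) (V W : axialSpace K)
    (a : I -> V) (b : I -> W) : {subset S <= S'} -> agree S' a b -> agree S a b.
Proof. by move=> SS' H p /SS'/H. Qed.

(** The linear form l in the combinations [lincomb (mu j) a], expressed in a. *)
Definition pullback (I J : finType) (mu : J -> {ffun I -> K}) (l : {ffun J -> K}) :
  {ffun I -> K} := [ffun i => \sum_j l j * mu j i].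

Definition pull (I J : finType) (mu : J -> {ffun I -> K})
    (S : seq ({ffun J -> K} * nat)) : seq ({ffun I -> K} * nat) :=
  [seq (pullback mu p.1, p.2) | p <- S].

Lemma lincomb_pullback (V : lmodType K) (I J : finType) (mu : J -> {ffun I -> K})
    l (a : I -> V) :
  lincomb (pullback mu l) a = lincomb l (fun j => lincomb (mu j) a).
Proof.
rewrite /lincomb; under eq_bigr do rewrite ffunE scaler_suml.
rewrite exchange_big; apply: eq_bigr => j _; rewrite scaler_sumr.
by apply: eq_bigr => i _; rewrite scalerA.
Qed.

Lemma agree_pull (I J : finType) (mu : J -> {ffun I -> K}) S (V W : axialSpace K)
    (a : I -> V) (b : I -> W) : agree (pull mu S) a b ->
  agree S (fun j => lincomb (mu j) a) (fun j => lincomb (mu j) b).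
Proof.
move=> H p pS; rewrite -!lincomb_pullback.
exact: (H _ (map_f (fun p => (pullback mu p.1, p.2)) pS)).
Qed.
End Agreement.

(** * Generic combinations and matching of axes *)

Section Generic.
Variable K : fieldType.
Hypothesis K_infinite : infinite_set [set: K].

Lemma large_uniq n : exists2 T : seq K, uniq T & size T = n.
Proof.
elim: n => [|n [T uT sT]]; first by exists [::].
have [[x xT]|H] := pselect (exists x, x \notin T).
  by exists (x :: T); rewrite /= ?xT ?sT.
exfalso; apply: K_infinite; apply/finite_seqP; exists T.
apply/seteqP; split=> x // _ /=; apply: contrapT => /negP xT.
by apply: H; exists x.
Qed.

(** Each x in s rules out at most one element of T. *)
Lemma avoid (A : eqType) (s : seq A) (T : seq K) (bad : A -> K -> bool) :
  uniq T -> (size s < size T)%N ->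
  {in s, forall x t u, bad x t -> bad x u -> t = u} ->
  exists2 t, t \in T & {in s, forall x, ~~ bad x t}.
Proof.
elim: s T => [[|t T] // _ _ _|x s IH T uT sT bad1].
  by exists t; rewrite ?mem_head.
have bads : {in s, forall x t u, bad x t -> bad x u -> t = u}.
  by move=> y ys; apply: bad1; rewrite inE ys orbT.
have [/hasP[u uinT bu]|/hasPn nb] := boolP (has (bad x) T).
  have [|||t] := IH (rem u T); rewrite ?rem_uniq ?size_rem //.
    by move: sT => /=; case: (size T).
  rewrite mem_rem_uniq // inE => /andP[tu tT] ts; exists t => // y.
  rewrite inE => /predU1P[->|/ts//]; apply: contra tu => bt.
  by apply/eqP; apply: bad1 bt bu; rewrite mem_head.
have [t tT ts] := IH T uT (ltnW sT) bads.
by exists t => // y; rewrite inE => /predU1P[->|/ts//]; apply: nb.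
Qed.

(** Coefficients are chosen one index q at a time: if the partial sum or the new
    vector [w e q] is nonzero, then at most one coefficient t makes
    [t *: w e q] cancel the partial sum, and T has more elements than there are
    families to care for.  Values outside F are zero, whence [0 :: T]. *)
Lemma generic_combination (V : lmodType K) (P : finType) (A : eqType) (s : seq A)
    (T : seq K) (w : A -> P -> V) : uniq T -> (size s < size T)%N ->
  forall F : {set P}, exists l : {ffun P -> K},
    [/\ forall p, l p \in 0 :: T, forall p, p \notin F -> l p = 0 &
    {in s, forall e, (exists2 p, p \in F & w e p != 0) ->
      \sum_p l p *: w e p != 0}].
Proof.
move=> uT sT F; suff [l [lT l0 ls]] : exists l : {ffun P -> K},
    [/\ forall p, l p \in 0 :: T, forall p, p \notin enum F -> l p = 0 &
    {in s, forall e, (exists2 p, p \in enum F & w e p != 0) ->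
      \sum_p l p *: w e p != 0}].
  exists l; split=> // [p pF|e es [p pF wp]]; first by apply: l0; rewrite mem_enum.
  by apply: ls => //; exists p; rewrite ?mem_enum.
elim: (enum F) => [|q G [l [lT l0 ls]]].
  by exists [ffun=> 0]; split=> [p|p _|e _ [//]]; rewrite ffunE ?mem_head.
have [qG|qG] := boolP (q \in G).
  exists l; split=> // [p|e es [p pG wp]].
    by rewrite inE negb_or => /andP[_]; apply: l0.
  apply: ls => //; exists p => //.
  by move: pG; rewrite inE => /predU1P[->|].
pose u e := \sum_p l p *: w e p.
pose bad e t := ((w e q != 0) || (u e != 0)) && (t *: w e q + u e == 0).
have [|t tT ts] := @avoid _ s T bad uT sT.
  move=> e es t t' /andP[e0 /eqP te] /andP[_ /eqP te'].
  have [w0|w0] := eqVneq (w e q) 0.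
    by move: e0; rewrite w0 eqxx /= => /eqP[]; rewrite -te w0 scaler0 add0r.
  apply/eqP; rewrite -subr_eq0; have /eqP : (t - t') *: w e q = 0.
    by rewrite scalerBl; apply/eqP; rewrite subr_eq0 -(inj_eq (addIr (u e))) te te'.
  by rewrite scaler_eq0 (negPf w0) orbF.
exists [ffun p => if p == q then t else l p]; split.
- by move=> p; rewrite ffunE; case: ifP => // _; rewrite inE tT orbT.
- by move=> p; rewrite inE negb_or ffunE => /andP[/negPf-> /l0].
move=> e es [p pG wp].
have -> : \sum_p [ffun p => if p == q then t else l p] p *: w e p = t *: w e q + u e.
  rewrite (bigD1 q) //= ffunE eqxx /u [\sum_p l p *: _](bigD1 q) //=.
  rewrite l0 // scale0r add0r; congr (_ + _); apply: eq_bigr => r rq.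
  by rewrite ffunE (negPf rq).
have := ts e es; rewrite /bad negb_and => /orP[|//].
rewrite negb_or !negbK => /andP[/eqP wq /eqP ue].
move: pG; rewrite inE => /predU1P[pq|pG]; first by rewrite pq wq eqxx in wp.
have := ls e es; rewrite -/(u e) ue eqxx => /(_ _)/negP[]//.
by exists p.
Qed.

(** The number of axes of E that meet the support of some [v p] with p in F. *)
Definition joint_rank (V : axialSpace K) (P : finType) (E : seq V) (v : P -> V)
    (F : {set P}) : nat :=
  count (fun e => [exists p in F, component e (v p) != 0]) E.

Section JointRank.
Variables (V : axialSpace K) (P : finType) (E : seq V) (k : nat) (v : P -> V).
Hypotheses (frE : frame (@onX K V) E) (kv : forall p, inXn k (v p)).
Hypothesis Ev : forall p, spanned E (v p).

Lemma component_lincomb e l : onX e -> e != 0 ->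
  component e (lincomb l v) = \sum_p l p *: component e (v p).
Proof.
move=> Xe e0; rewrite component_sum //; last by move=> p _ _; exists k; apply: inXnZ.
by apply: eq_bigr => p _; rewrite (componentZ Xe e0 _ (kv p)).
Qed.

Lemma lincomb_rank l j :
  inXn j (lincomb l v) <-> (count (fun e => component e (lincomb l v) != 0%R) E <= j)%N.
Proof.
have kl p : inXn k (l p *: v p) by apply: inXnZ.
have kE p : spanned E (l p *: v p).
  rewrite /spanned {1}(Ev p) scaler_sumr; apply: eq_big_seq => e.
  by case: frE => _ EX _ /EX/andP[Xe e0]; rewrite (componentZ Xe e0 _ (kv p)).
apply: (@spanned_rank _ _ _ _ _ _ frE).
  by apply: (@inXn_sum _ _ _ _ _ k) => p _ _; apply: kl.
by apply: spanned_sum => // p _ _; exists k.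
Qed.

Lemma joint_rank_max (F : {set P}) (l : {ffun P -> K}) j : (forall p, p \notin F -> l p = 0) ->
  (joint_rank E v F <= j)%N -> inXn j (lincomb l v).
Proof.
move=> l0 Fj; apply/lincomb_rank; apply: leq_trans Fj.
rewrite /joint_rank -!size_filter; apply: uniq_leq_size.
  by case: frE => uE _ _; apply: filter_uniq.
move=> e; rewrite !mem_filter => /andP[ce eE]; rewrite eE andbT.
have /andP[Xe e0] : onX e && (e != 0) by case: frE => _ EX _; apply: EX.
move: ce; rewrite component_lincomb //; apply: contraR.
rewrite negb_exists => /forallP H; rewrite big1 // => p _.
have := H p; rewrite negb_and => /orP[/l0->|]; first by rewrite scale0r.
by rewrite negbK => /eqP->; rewrite scaler0.
Qed.

Lemma joint_rank_attained T (F : {set P}) : uniq T -> (size E < size T)%N ->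
  exists l : {ffun P -> K}, [/\ forall p, l p \in 0 :: T,
    forall p, p \notin F -> l p = 0 &
    forall j, inXn j (lincomb l v) -> (joint_rank E v F <= j)%N].
Proof.
move=> uT sT.
have [l [lT l0 lE]] := generic_combination (fun e p => component e (v p)) uT sT F.
exists l; split=> // j /lincomb_rank; apply: leq_trans.
rewrite /joint_rank -!size_filter; apply: uniq_leq_size.
  by case: frE => uE _ _; apply: filter_uniq.
move=> e; rewrite !mem_filter => /andP[/existsP[p /andP[pF cp]] eE].
rewrite eE andbT; have /andP[Xe e0] : onX e && (e != 0) by case: frE => _ EX _; apply: EX.
by rewrite component_lincomb //; apply: lE => //; exists p.
Qed.
End JointRank.

Definition valued_in (P : finType) (T : seq K) : seq {ffun P -> K} :=
  [seq [ffun p => ssval (g p)] | g : {ffun P -> seq_sub T}].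

Lemma valued_inP (P : finType) (T : seq K) (l : {ffun P -> K}) :
  (forall p, l p \in T) -> l \in valued_in P T.
Proof.
move=> lT; apply/fintype.imageP; exists [ffun p => SeqSub (lT p)] => //.
by apply/ffunP => p; rewrite !ffunE.
Qed.

(** In V the joint rank is the rank of a generic combination; the combination of
    the w with the same coefficients has at most their joint rank, and by
    agreement that bound passes to V. *)
Lemma joint_rank_le (V W : axialSpace K) (P : finType) (E : seq V) (E' : seq W)
    (v : P -> V) (w : P -> W) k B T :
  frame (@onX K V) E -> frame (@onX K W) E' ->
  (size E <= B)%N -> (size E' <= B)%N -> uniq T -> (B < size T)%N ->
  (forall p, inXn k (v p)) -> (forall p, inXn k (w p)) ->
  (forall p, spanned E (v p)) -> (forall p, spanned E' (w p)) ->
  agree [seq (l, j) | l <- valued_in P (0 :: T), j <- iota 0 B.+1] v w ->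
  forall F, (joint_rank E v F <= joint_rank E' w F)%N.
Proof.
move=> fE fE' sE sE' uT sT kv kw Ev Ew vw F.
have [|l [lT l0 ->//]] := joint_rank_attained fE kv Ev F uT; first exact: leq_ltn_trans sT.
have lw : inXn (joint_rank E' w F) (lincomb l w) by apply: (joint_rank_max fE' kw Ew l0).
apply: (vw (l, joint_rank E' w F) _).2 lw.
apply: allpairs_f; first exact: valued_inP.
by rewrite mem_iota add0n ltnS (leq_trans (count_size _ _)).
Qed.

Lemma frame_nil (V : axialSpace K) : frame (@onX K V) [::].
Proof. by []. Qed.

(** The joint ranks of v and w agree for all F, hence the axes with a given
    pattern of zero components are equally many on both sides, except for the
    pattern of all zeros.  The latter is that of any axis off the frame, and
    there are infinitely many axes. *)
Lemma same_pattern (P : finType) k : exists S : seq ({ffun P -> K} * nat),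
  forall (V W : axialSpace K) (v : P -> V) (w : P -> W),
  (forall p, inXn k (v p)) -> (forall p, inXn k (w p)) -> agree S v w ->
  forall x, onX x -> x != 0 -> exists y, [/\ onX y, y != 0 &
    forall p, (component x (v p) == 0) = (component y (w p) == 0)].
Proof.
pose B := (#|P| * k)%N; have [T uT sT] := large_uniq B.+1.
exists [seq (l, j) | l <- valued_in P (0 :: T), j <- iota 0 B.+1].
move=> V W v w kv kw vw x Xx x0.
have frames (U : axialSpace K) (u : P -> U) : (forall p, inXn k (u p)) ->
    exists E, [/\ frame (@onX K U) E, (size E <= B)%N & forall p, spanned E (u p)].
  move=> ku; have [|E [fE sE Eu]] := @spanning_frame _ _ _ k (codom u) (@frame_nil U).
    by move=> _ /codomP[p ->].
  rewrite cats0 in fE Eu; exists E; split=> //; first by rewrite size_codom in sE.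
  by move=> p; apply: Eu; apply: codom_f.
have [E [fE sE Ev]] := frames _ v kv; have [E' [fE' sE' Ew]] := frames _ w kw.
pose Z (U : axialSpace K) (u : P -> U) e : {set P} := [set p | component e (u p) == 0].
have jointZ (U : axialSpace K) (u : P -> U) D (F : {set P}) :
    count (fun Q : {set P} => ~~ (F \subset Q)) (map (Z U u) D) = joint_rank D u F.
  rewrite count_map; apply: eq_count => e /=; apply/subsetPn/existsP.
    by case=> p pF; rewrite inE => pe; exists p; rewrite pF.
  by case=> p /andP[pF pe]; exists p; rewrite ?inE.
have EE' (F : {set P}) : count (fun Q : {set P} => ~~ (F \subset Q)) (map (Z V v) E) =
             count (fun Q : {set P} => ~~ (F \subset Q)) (map (Z W w) E').
  rewrite !jointZ; apply/eqP; rewrite eqn_leq.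
  rewrite !(@joint_rank_le _ _ _ _ _ _ _ k B T) ?sT //; exact: agree_sym.
have [ZT|ZT] := eqVneq (Z V v x) [set: P].
  have [y [Xy y0 yE']] := off_frame fE'; exists y; split=> // p.
  rewrite (component_off fE' Xy y0 yE' (Ew p)) eqxx.
  have : p \in Z V v x by rewrite ZT finset.in_setT.
  by rewrite finset.inE => ->.
have [Ex|Ex] := boolP (has (on_axis (@onX K V) ^~ x) E); last first.
  case/eqP: ZT; apply/setP => p; rewrite !inE.
  by rewrite (component_off fE Xx x0 Ex (Ev p)) eqxx.
have [e eE ex] := hasP Ex; have /andP[Xe e0] : onX e && (e != 0).
  by case: fE => _ EX _; apply: EX.
have : Z V v x \in map (Z W w) E'.
  rewrite -has_pred1 has_count -(count_pattern EE') // -has_count has_pred1.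
  apply/mapP; exists e => //; apply/setP => p; rewrite !inE.
  by rewrite (component_eq _ Xe e0 x0 ex).
case/mapP => y yE' ZE; have /andP[Xy y0] : onX y && (y != 0).
  by case: fE' => _ EX _; apply: EX.
by exists y; split=> // p; move/setP/(_ p): ZE; rewrite !inE.
Qed.
End Generic.

(** * One-point extensions *)

Section Extension.
Variable K : fieldType.
Hypothesis K_infinite : infinite_set [set: K].

(** Applying [same_pattern] to the differences of the c, with 0 adjoined as the
    value at None, gives an axis with representative z on which the components
    of the d coincide for the same pairs as those of the c do on the axis of x.
    If x is the component of some [c i1], then y must be that of [d i1];
    otherwise y is a multiple of z different from all components of the d. *)
Lemma same_translates (I : finType) k : exists S : seq ({ffun I -> K} * nat),
  forall (V W : axialSpace K) (c : I -> V) (d : I -> W),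
  (forall i, inXn k (c i)) -> (forall i, inXn k (d i)) -> agree S c d ->
  forall x, onX x -> x != 0 -> exists y, [/\ onX y, y != 0 &
    forall i j, inXn j (c i - x) <-> inXn j (d i - y)].
Proof.
pose delta i : {ffun I -> K} := [ffun i' => (i' == i)%:R].
pose odelta o : {ffun I -> K} := oapp delta 0 o.
have deltaE (U : axialSpace K) (a : I -> U) i : lincomb (delta i) a = a i.
  rewrite /lincomb (bigD1 i) //= ffunE eqxx scale1r big1 ?addr0 // => j ji.
  by rewrite ffunE (negPf ji) scale0r.
have odeltaE (U : axialSpace K) (a : I -> U) o : lincomb (odelta o) a = oapp a 0 o.
  case: o => [i|] /=; first exact: deltaE.
  by rewrite /lincomb big1 // => i _; rewrite ffunE scale0r.
pose mu (p : option I * option I) := odelta p.1 - odelta p.2.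
have muE (U : axialSpace K) (a : I -> U) p :
    lincomb (mu p) a = oapp a 0 p.1 - oapp a 0 p.2.
  rewrite -!odeltaE /lincomb -sumrB; apply: eq_bigr => i _.
  by rewrite !ffunE scalerBl.
have [S0 S0P] := @same_pattern K K_infinite (option I * option I)%type (k + k).
exists (pull mu S0 ++ [seq (delta i, j) | i <- enum I, j <- iota 0 k.+1]).
move=> V W c d kc kd cd x Xx x0.
have oinX (U : axialSpace K) (a : I -> U) o : (forall i, inXn k (a i)) -> inXn k (oapp a 0 o).
  by case: o => [i|] ka //=; apply: inXn0.
have muX (U : axialSpace K) (a : I -> U) p : (forall i, inXn k (a i)) ->
    inXn (k + k) (lincomb (mu p) a).
  by move=> ka; rewrite muE; apply: inXnB; apply: oinX.
have cdS0 : agree S0 (fun p => lincomb (mu p) c) (fun p => lincomb (mu p) d).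
  by apply: agree_pull; apply: agree_sub cd => s; rewrite mem_cat => ->.
have [z [Xz z0 zP]] := S0P V W _ _ (fun p => muX V c p kc)
  (fun p => muX W d p kd) cdS0 x Xx x0.
have compB (U : axialSpace K) (a : I -> U) e o o' : (forall i, inXn k (a i)) ->
    onX e -> e != 0 ->
    (component e (lincomb (mu (o, o')) a) == 0) =
    (component e (oapp a 0 o) == component e (oapp a 0 o')).
  move=> ka Xe e0; rewrite muE -scaleN1r.
  rewrite (componentD Xe e0 (oinX _ _ _ ka) (inXnZ _ (oinX _ _ _ ka))).
  by rewrite (componentZ Xe e0 _ (oinX _ _ _ ka)) scaleN1r subr_eq0.
have {zP} zP o o' : (component x (oapp c 0 o) == component x (oapp c 0 o')) =
    (component z (oapp d 0 o) == component z (oapp d 0 o')).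
  by rewrite -!compB // zP.
have [y [Xy y0 zy yP]] : exists y, [/\ onX y, y != 0, on_axis (@onX K W) z y &
    forall i, (component x (c i) == x) = (component z (d i) == y)].
  have [[i1 /eqP ci1]|nox] := pselect (exists i, component x (c i) == x).
    exists (component z (d i1)).
    have zd := component_axis Xz z0 (d i1).
    split=> //; first by case/andP: zd.
      have := zP (Some i1) None; rewrite /= !component0 // ci1 => <-.
      by [].
    by move=> i; rewrite -{2}ci1; apply: (zP (Some i) (Some i1)).
  have [T uT sT] := large_uniq K_infinite #|{: option I}|.+1.
  have [|||t tT tP] := @avoid _ _ (enum {: option I}) T
      (fun o t => t *: z == component z (oapp d 0 o)).
  - by [].
  - by rewrite -cardE sT.
  - move=> o _ t u /eqP tz /eqP uz; apply/eqP; rewrite -subr_eq0.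
    have /eqP : (t - u) *: z = 0 by rewrite scalerBl tz uz subrr.
    by rewrite scaler_eq0 (negPf z0) orbF.
  have zt : on_axis (@onX K W) z (t *: z) by apply: axisZ => //; apply: axis_refl.
  exists (t *: z); split=> //; first by case/andP: zt.
    by have := tP None; rewrite mem_enum /= component0 // => ->.
  move=> i; have /negPf := tP (Some i) (mem_enum _ _); rewrite eq_sym /= => ->.
  by apply/negP => ci; apply: nox; exists i.
exists y; split=> // i.
have [r rP] := rank_translate Xx x0 (kc i); have [s sP] := rank_translate Xy y0 (kd i).
have yz : component y (d i) = component z (d i) by rewrite (component_eq _ Xz z0 y0 zy).
have e0 : (component x (c i) != 0) = (component y (d i) != 0).
  by have := zP (Some i) None; rewrite /= !component0 // yz => ->.
have e1 : (component x (c i) != x) = (component y (d i) != y) by rewrite yz yP.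
have rs : r = s.
  have /(rP k).1 rk := kc i; have /(sP k).1 sk := kd i.
  have E j : (j <= k)%N -> (r + (component x (c i) != 0%R) <= j)%N <->
      (s + (component x (c i) != 0%R) <= j)%N.
    move=> jk; rewrite {2}e0 -(rP j).1 -(sP j).1 -{1}(deltaE V c) -(deltaE W d).
    apply: (cd (delta i, j)); rewrite mem_cat allpairs_f ?orbT ?mem_enum //.
    by rewrite mem_iota add0n ltnS.
  rewrite -e0 in sk.
  apply/eqP; rewrite -(eqn_add2r (component x (c i) != 0)) eqn_leq.
  by rewrite (E _ sk).2 ?(E _ rk).1.
by move=> j; rewrite (rP j).2 (sP j).2 rs e1.
Qed.

(** The same function as [env_cons], for types that are not structures, so that
    environments convert to tuples of vectors. *)
Definition vcons (V : Type) n (x : V) (a : 'I_n -> V) : 'I_n.+1 -> V :=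
  fun i => if unlift ord0 i is Some j then a j else x.

Definition tail n (l : {ffun 'I_n.+1 -> K}) : {ffun 'I_n -> K} := [ffun i => l (lift ord0 i)].

Lemma lincomb_vcons (V : lmodType K) n (l : {ffun 'I_n.+1 -> K}) (x : V) (a : 'I_n -> V) :
  lincomb l (vcons x a) = l ord0 *: x + lincomb (tail l) a.
Proof.
rewrite /lincomb big_ord_recl /vcons unlift_none; congr (_ + _).
by apply: eq_bigr => i _; rewrite liftK ffunE.
Qed.

Definition extends (P : forall V : axialSpace K, V -> Prop) : Prop :=
  forall n (S : seq ({ffun 'I_n.+1 -> K} * nat)),
  exists S' : seq ({ffun 'I_n -> K} * nat),
  forall (V W : axialSpace K) (a : 'I_n -> V) (b : 'I_n -> W), agree S' a b ->
  forall x, P V x -> exists2 y, P W y & agree S (vcons x a) (vcons y b).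

Definition tails n (S : seq ({ffun 'I_n.+1 -> K} * nat)) := [seq (tail p.1, p.2) | p <- S].

Lemma agree_tails n S (V W : axialSpace K) (a : 'I_n -> V) (b : 'I_n -> W) :
  agree (tails S) a b -> {in S, forall p,
    inXn p.2 (lincomb (tail p.1) a) <-> inXn p.2 (lincomb (tail p.1) b)}.
Proof.
by move=> H p pS; apply: (H _ (map_f (fun p => (tail p.1, p.2)) pS)).
Qed.

Lemma agree_vcons0 n S (V W : axialSpace K) (a : 'I_n -> V) (b : 'I_n -> W) :
  agree (tails S) a b -> agree S (vcons 0 a) (vcons 0 b).
Proof.
move=> H p pS; rewrite !lincomb_vcons !scaler0 !add0r; exact: agree_tails pS.
Qed.

Definition bound (A : Type) (S : seq (A * nat)) : nat := (\max_(p <- S) p.2)%N.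

Lemma bound_le (A : eqType) (S : seq (A * nat)) : {in S, forall p, (p.2 <= bound S)%N}.
Proof. by move=> p pS; rewrite /bound (big_rem p) //= leq_maxl. Qed.

(** Up to the factor [l ord0], the combination l of (x, a) is the difference of x
    and a combination of a, its center; rank conditions on it are conditions on
    the distance from x to the center. *)
Definition center n (l : {ffun 'I_n.+1 -> K}) : {ffun 'I_n -> K} :=
  [ffun i => - (l ord0)^-1 * l (lift ord0 i)].

Lemma lincomb_center (V : lmodType K) n (l : {ffun 'I_n.+1 -> K}) (x : V) (a : 'I_n -> V) :
  l ord0 != 0 -> lincomb l (vcons x a) = l ord0 *: (x - lincomb (center l) a).
Proof.
move=> l0; rewrite lincomb_vcons scalerBr; congr (_ + _).
rewrite /lincomb scaler_sumr -sumrN; apply: eq_bigr => i _.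
by rewrite !ffunE scalerA mulrA mulrN mulfV // mulN1r scaleNr opprK.
Qed.

Lemma inXn_center (V : axialSpace K) j n (l : {ffun 'I_n.+1 -> K}) (x : V) (a : 'I_n -> V) :
  l ord0 != 0 -> inXn j (lincomb l (vcons x a)) <-> inXn j (lincomb (center l) a - x).
Proof.
move=> l0; have -> : lincomb l (vcons x a) = - l ord0 *: (lincomb (center l) a - x).
  by rewrite lincomb_center // -[in LHS]opprB scalerN scaleNr.
by rewrite inXnZ_iff // oppr_eq0.
Qed.

(** [same_translates] needs centers of bounded rank.  A center of larger rank
    stays at distance more than [bound S] from each element of X, so it may be
    replaced by 0.  Which centers are to be kept depends on the tuple a, hence
    the conditions for all subsets B are put into the list. *)
Lemma extends_X : extends (fun V => @onX K V).
Proof.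
move=> n S.
(* a center at distance at most j from an element of X has rank at most j + 1 *)
pose k := (bound S).+1; pose I := 'I_(size S).
pose p0 : {ffun 'I_n.+1 -> K} * nat := (0, 0%N).
pose l (i : I) := (nth p0 S i).1.
pose mask (B : {set I}) i : {ffun 'I_n -> K} := if i \in B then center (l i) else 0.
have [S0 S0P] := same_translates I k.
exists (tails S ++ ([seq (center (l i), k) | i <- enum I] ++
  flatten [seq pull (mask B) S0 | B <- enum {: {set I}}])).
move=> V W a b ab x Xx.
have abt : agree (tails S) a b by apply: agree_sub ab => s; rewrite mem_cat => ->.
have [->|x0] := eqVneq x 0; first by exists 0; [exact: onX0|exact: agree_vcons0].
have abc i : inXn k (lincomb (center (l i)) a) <-> inXn k (lincomb (center (l i)) b).
  apply: (ab (center (l i), k)); rewrite !mem_cat map_f ?orbT //.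
  by rewrite mem_enum.
pose B : {set I} := [set i | `[< inXn k (lincomb (center (l i)) a) >]].
have maskX (U : axialSpace K) (e : 'I_n -> U) :
    (forall i, i \in B -> inXn k (lincomb (center (l i)) e)) ->
    forall i, inXn k (lincomb (mask B i) e).
  move=> H i; rewrite /mask; case: ifP => [/H//|_].
  by rewrite /lincomb big1 => [|j _]; [exact: inXn0|rewrite ffunE scale0r].
have [|||y [Xy y0 yP]] := S0P V W _ _ (maskX V a _) (maskX W b _) _ x Xx x0.
- by move=> i; rewrite inE => /asboolP.
- by move=> i; rewrite inE => /asboolP/abc.
- apply: agree_pull; apply: agree_sub ab => s sB; rewrite !mem_cat.
  apply/orP; right; apply/orP; right; apply/flattenP.
  by exists (pull (mask B) S0) => //; apply: map_f; rewrite mem_enum.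
exists y => // p pS; have ps : (index p S < size S)%N by rewrite index_mem.
have pE : p.1 = l (Ordinal ps) by rewrite /l /= nth_index.
have [q0|q0] := eqVneq (p.1 ord0) 0.
  by rewrite !lincomb_vcons q0 !scale0r !add0r; apply: agree_tails pS.
rewrite !inXn_center // pE; set i := Ordinal ps.
have [iB|iB] := boolP (i \in B).
  by have := yP i p.2; rewrite /mask iB.
have near (U : axialSpace K) (e : 'I_n -> U) z : onX z ->
    inXn p.2 (lincomb (center (l i)) e - z) -> inXn k (lincomb (center (l i)) e).
  move=> /inXn1 Xz H; rewrite -[lincomb _ _](subrK z).
  by apply: (inXn_le _ (inXnD H Xz)); rewrite addn1 ltnS bound_le.
have na : ~ inXn k (lincomb (center (l i)) a) by move/asboolP => H; rewrite inE H in iB.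
by split=> [/(near _ _ _ Xx)|/(near _ _ _ Xy)/abc].
Qed.

Lemma inXnS (V : axialSpace K) r (v : V) : inXn r.+1 v <->
  exists x w, [/\ onX x, inXn r w & v = x + w].
Proof.
split=> [[[|y ys] [sys /= Xys ->]]|[x [w [/inXn1 Xx rw ->]]]].
- by exists 0, 0; split; [exact: onX0|exact: inXn0|rewrite big_nil addr0].
- case/andP: Xys => Xy Xys; exists y, (\sum_(z <- ys) z); rewrite big_cons.
  by split=> //; exists ys.
exact: (inXnD Xx rw).
Qed.

(** Adding x1 in X to the tuple first and then the remaining r summands, the
    form l becomes the form with the same coefficient at both new vectors. *)
Lemma extends_inXn r : extends (fun V => @inXn K V r).
Proof.
elim: r => [|r IH] n S.
  exists (tails S) => V W a b ab x [[|y ys] [//= _ _ ->]].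
  by exists 0; [exact: inXn0|rewrite big_nil; apply: agree_vcons0].
pose dup (l : {ffun 'I_n.+1 -> K}) : {ffun 'I_n.+2 -> K} :=
  [ffun i => vcons (l ord0) l i].
have dupE (U : axialSpace K) l (x w : U) (a : 'I_n -> U) :
    lincomb (dup l) (vcons w (vcons x a)) = lincomb l (vcons (x + w) a).
  have -> : lincomb (dup l) (vcons w (vcons x a)) = l ord0 *: w + lincomb l (vcons x a).
    rewrite lincomb_vcons ffunE /vcons unlift_none; congr (_ + lincomb _ _).
    by apply/ffunP => i; rewrite !ffunE /vcons liftK.
  by rewrite !lincomb_vcons scalerDr -addrA addrCA.
have [S1 S1P] := IH _ [seq (dup p.1, p.2) | p <- S].
have [S2 S2P] := extends_X S1.
exists S2 => V W a b /S2P abX x /inXnS[x1 [x2 [/abX[y1 Xy1 /S1P xy1] /xy1[y2 ry2 xy2] ->]]].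
exists (y1 + y2); first by apply/inXnS; exists y1, y2.
move=> p pS; rewrite -!dupE.
exact: (xy2 _ (map_f (fun p => (dup p.1, p.2)) pS)).
Qed.

(** The sum of a frame of size n has rank n, so it is far from all vectors of
    rank much less than n, and at infinite distance from those outside the span
    of X. *)
Lemma far_point (V : axialSpace K) (s : seq V) k :
  exists y, {in s, forall z, ~ inXn k (z - y)}.
Proof.
have [R RP] : exists R, {in s, forall z j, inXn j z -> inXn R z}.
  elim: s => [|z s [R RP]]; first by exists 0%N.
  have [[j zj]|nz] := pselect (exists j, inXn j z).
    exists (maxn j R) => w; rewrite inE => /predU1P[->|ws] i wi.
      by apply: inXn_le zj; rewrite leq_maxl.
    by apply: inXn_le (RP w ws i wi); rewrite leq_maxr.
  exists R => w; rewrite inE => /predU1P[->|ws] i wi; last exact: RP wi.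
  by case: nz; exists i.
(* distance at most k from some z in s would bound the rank of y by R + k *)
have [E fE sE] := frame_large V (R + k).+1; have [uE EX Einj] := fE.
have XE : all (@onX K V) E by apply/allP => e /EX/andP[].
pose y := \sum_(e <- E) e.
have cy : {in E, forall e, component e y = e}.
  move=> e eE; have /andP[Xe e0] := EX e eE.
  rewrite componentE // (big_rem e) //= axis_refl // big_seq_cond big1 ?addr0 //.
  move=> f; rewrite mem_rem_uniq // inE => /andP[/andP[fe fE'] ef].
  by case/eqP: fe; rewrite (Einj e f).
have yE : spanned E y by rewrite /spanned; apply: eq_big_seq => e /cy.
have yX : inXn (size E) y by exists E.
exists y => z zs kz.
have Rz : inXn R z by apply: (RP z zs (k + size E)%N); rewrite -[z](subrK y); apply: inXnD.
have : inXn (R + k) y by rewrite -[y](subKr z); apply: inXnB.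
move/(spanned_rank _ fE yX yE); rewrite (eq_in_count (a2 := xpredT)) ?count_predT ?sE ?ltnn //.
by move=> e eE; rewrite cy //; case/andP: (EX e eE).
Qed.

(** If x is within [bound S] of the center of some form in S, their difference is
    in X^k and [extends_inXn] applies to it; otherwise y is to be far from all
    centers. *)
Lemma extends_all : extends (fun _ _ => True).
Proof.
move=> n S; pose k := bound S.
pose shift (c : {ffun 'I_n -> K}) (l : {ffun 'I_n.+1 -> K}) : {ffun 'I_n.+1 -> K} :=
  [ffun i => l i + (if unlift ord0 i is Some j then l ord0 * c j else 0)].
have shiftE (U : axialSpace K) c l (x : U) (a : 'I_n -> U) :
    lincomb (shift c l) (vcons x a) = lincomb l (vcons (x + lincomb c a) a).
  rewrite !lincomb_vcons ffunE unlift_none addr0 scalerDr -addrA; congr (_ + _).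
  rewrite addrC /lincomb scaler_sumr -big_split; apply: eq_bigr => i _.
  by rewrite !ffunE liftK scalerDl scalerA.
have [S1 S1P] := extends_inXn k
  (flatten [seq [seq (shift (center p.1) q.1, q.2) | q <- S] | p <- S]).
exists (tails S ++ S1) => V W a b ab x _.
have abt : agree (tails S) a b by apply: agree_sub ab => s; rewrite mem_cat => ->.
have ab1 : agree S1 a b by apply: agree_sub ab => s; rewrite mem_cat orbC => ->.
have [[p pS [p0 px]]|far] := pselect
    (exists2 p, p \in S & p.1 ord0 != 0 /\ inXn p.2 (lincomb p.1 (vcons x a))).
  have kx : inXn k (x - lincomb (center p.1) a).
    apply: (inXn_le (bound_le pS)); move: px; rewrite lincomb_center // inXnZ_iff //.
  have [y ky xy] := S1P _ _ _ _ ab1 _ kx.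
  exists (y + lincomb (center p.1) b) => // q qS.
  have := xy (shift (center p.1) q.1, q.2); rewrite !shiftE subrK; apply.
  apply/flattenP; exists [seq (shift (center p.1) q.1, q.2) | q <- S].
    exact: (map_f (fun p => [seq (shift (center p.1) q.1, q.2) | q <- S])).
  exact: (map_f (fun q => (shift (center p.1) q.1, q.2))).
have [y yP] := far_point [seq lincomb (center p.1) b | p <- S] k.
exists y => // p pS; have [q0|q0] := eqVneq (p.1 ord0) 0.
  by rewrite !lincomb_vcons q0 !scale0r !add0r; apply: agree_tails pS.
split=> [px|]; first by case: far; exists p.
rewrite inXn_center // => py; case: (yP (lincomb (center p.1) b)).
  exact: (map_f (fun p => lincomb (center p.1) b)).
exact: inXn_le (bound_le pS) py.
Qed.
End Extension.

(** * Satisfaction of iterated connectives and quantifiers; separation *)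

Section Environments.
Variables (L : language) (M : structure L).

Lemma env_cons0 n (a : M) (e : 'I_n -> M) : env_cons a e ord0 = a.
Proof. by rewrite /env_cons unlift_none. Qed.

Lemma env_consS n (a : M) (e : 'I_n -> M) i : env_cons a e (lift ord0 i) = e i.
Proof. by rewrite /env_cons liftK. Qed.

Definition env_cat k n (a : 'I_k -> M) (e : 'I_n -> M) : 'I_(k + n) -> M :=
  fun i => match split i with inl j => a j | inr j => e j end.

Lemma env_catl k n (a : 'I_k -> M) (e : 'I_n -> M) i : env_cat a e (lshift n i) = a i.
Proof. by rewrite /env_cat (unsplitK (inl _ i)). Qed.

Lemma env_catr k n (a : 'I_k -> M) (e : 'I_n -> M) i : env_cat a e (rshift k i) = e i.
Proof. by rewrite /env_cat (unsplitK (inr _ i)). Qed.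

Lemma env_cat0 n (a : 'I_0 -> M) (e : 'I_n -> M) : env_cat a e = e.
Proof.
apply: funext => i; have ir : i = rshift 0 i by apply: val_inj.
by rewrite [in LHS]ir env_catr.
Qed.

Lemma env_catS k n (a : 'I_k.+1 -> M) (e : 'I_n -> M) :
  env_cons (a ord0) (env_cat (a \o lift ord0) e) = env_cat a e.
Proof.
apply: funext => i; case: (split_ordP (i : 'I_(k.+1 + n))) => j ->.
  rewrite env_catl; case: (unliftP ord0 j) => [h ->|->].
    have -> : lshift n (lift ord0 h) = lift ord0 (lshift n h) by apply: val_inj.
    by rewrite (env_consS (n := k + n)) env_catl.
  have -> : lshift n (ord0 : 'I_k.+1) = ord0 by apply: val_inj.
  exact: (env_cons0 (n := k + n)).
rewrite env_catr; have -> : rshift k.+1 j = lift ord0 (rshift k j).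
  by apply: val_inj; rewrite /= /bump leq0n add1n addSn.
by rewrite (env_consS (n := k + n)) env_catr.
Qed.

Lemma env_cat_cons k n x (a : 'I_k -> M) (e : 'I_n -> M) :
  env_cat (env_cons x a) e = env_cons x (env_cat a e).
Proof.
rewrite -env_catS env_cons0; congr (env_cons x (env_cat _ e)).
by apply: funext => i; rewrite /= env_consS.
Qed.

Lemma sat_Iff n (e : 'I_n -> M) (p q : formula L n) :
  sat e (Iff p q) <-> (sat e p <-> sat e q).
Proof. by split=> -[]. Qed.

Lemma sat_And n (e : 'I_n -> M) (p q : formula L n) :
  sat e (And p q) = (sat e p /\ sat e q).
Proof. by []. Qed.

Lemma sat_Imp n (e : 'I_n -> M) (p q : formula L n) :
  sat e (Imp p q) = (sat e p -> sat e q).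
Proof. by []. Qed.

Lemma sat_Not n (e : 'I_n -> M) (p : formula L n) :
  sat e (Not p) = ~ sat e p.
Proof. by []. Qed.

Lemma sat_All n (e : 'I_n -> M) (p : formula L n.+1) :
  sat e (All p) = (forall a, sat (env_cons a e) p).
Proof. by []. Qed.

Lemma sat_Ex n (e : 'I_n -> M) (p : formula L n.+1) :
  sat e (Ex p) = (exists a, sat (env_cons a e) p).
Proof. by []. Qed.

Lemma sat_Exs k n (p : formula L (k + n)) (e : 'I_n -> M) :
  sat e (Exs k p) <-> exists a, sat (env_cat a e) p.
Proof.
elim: k p => [|k IH] p /=.
  split=> [ep|[a]]; last by rewrite env_cat0.
  by exists (fun i : 'I_0 => match notF (ltn_ord i) with end); rewrite env_cat0.
split=> [/IH[a [x axp]]|[a ap]]; first by exists (env_cons x a); rewrite env_cat_cons.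
by apply/IH; exists (a \o lift ord0), (a ord0); rewrite env_catS.
Qed.

Lemma sat_Alls k n (p : formula L (k + n)) (e : 'I_n -> M) :
  sat e (Alls k p) <-> forall a, sat (env_cat a e) p.
Proof.
elim: k p => [|k IH] p /=.
  split=> [ep a|]; first by rewrite env_cat0.
  by move=> /(_ (fun i : 'I_0 => match notF (ltn_ord i) with end)); rewrite env_cat0.
split=> [/IH ep a|ep]; first by rewrite -env_catS; apply: ep.
by apply/IH => a x; rewrite -env_cat_cons; apply: ep.
Qed.

Lemma sat_bigAnd n (e : 'I_n -> M) k (P : pred 'I_k) (F : 'I_k -> formula L n) :
  sat e (\big[@And L n/Top]_(i < k | P i) F i) <-> forall i, P i -> sat e (F i).
Proof.
suff H (s : seq 'I_k) : sat e (\big[@And L n/Top]_(i <- s | P i) F i) <->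
    {in s, forall i, P i -> sat e (F i)}.
  rewrite H; split=> eF i; [apply: eF; exact: mem_index_enum|by move=> _; apply: eF].
elim: s => [|i s IH]; first by rewrite big_nil; split=> // _ [].
rewrite big_cons; case: ifP => Pi.
  split=> [[ei /IH es] j|eF]; first by rewrite inE => /predU1P[->//|]; apply: es.
  split; first by apply: eF => //; rewrite mem_head.
  by apply/IH => j js; apply: eF; rewrite inE js orbT.
rewrite IH; split=> eF j js Pj; last by apply: eF => //; rewrite inE js orbT.
by apply: eF => //; move: js Pj; rewrite inE => /predU1P[->|//]; rewrite Pi.
Qed.
End Environments.

Section Separation.
Variables (L : language) (T : set (sentence L)) (n : nat).

Fixpoint agree_on (Psi : seq (formula L n)) (M N : structure L)
    (a : 'I_n -> M) (b : 'I_n -> N) : Prop :=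
  if Psi is p :: Psi' then (sat a p <-> sat b p) /\ agree_on Psi' a b else True.

Lemma agree_on_refl Psi (M : structure L) (a : 'I_n -> M) : agree_on Psi a a.
Proof. by elim: Psi => //= p Psi IH. Qed.

Lemma agree_on_trans Psi (M N Q : structure L) (a : 'I_n -> M) (b : 'I_n -> N)
    (c : 'I_n -> Q) : agree_on Psi a b -> agree_on Psi b c -> agree_on Psi a c.
Proof.
by elim: Psi => //= p Psi IH [ab abP] [bc /(IH abP)]; rewrite ab bc.
Qed.

Fixpoint all_qf (Psi : seq (formula L n)) : Prop :=
  if Psi is p :: Psi' then quantifier_free p /\ all_qf Psi' else True.

(** Induction on the list of conditions: for the first condition p, the two
    predicates saying that some tuple with the same values on the other
    conditions satisfies Q, and p or not p respectively, are definable by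
    induction, and Q is put together from them by cases on p. *)
Lemma qf_definable Psi (Q : forall M : structure L, ('I_n -> M) -> Prop) :
  all_qf Psi ->
  (forall (M N : structure L) (a : 'I_n -> M) (b : 'I_n -> N), models M T -> models N T ->
    agree_on Psi a b -> Q M a -> Q N b) ->
  exists2 psi, quantifier_free psi &
    forall (M : structure L) (a : 'I_n -> M), models M T -> Q M a <-> sat a psi.
Proof.
elim: Psi Q => [|p Psi IH] Q /= qf QP.
  (* without conditions, Q holds of all tuples or of none *)
  have [[M [a [TM Qa]]]|H] := pselect
      (exists (M : structure L) (a : 'I_n -> M), models M T /\ Q M a).
    by exists Top => //= N b TN; split=> // _; apply: QP Qa.
  by exists Bot => //= N b TN; split=> // Qb; apply: H; exists N, b.
case: qf => qfp qfPsi.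
pose R (c : Prop -> Prop) (M : structure L) (a : 'I_n -> M) :=
  exists (N : structure L) (b : 'I_n -> N),
    [/\ models N T, agree_on Psi b a, c (sat b p) & Q N b].
have RP c : exists2 psi, quantifier_free psi &
    forall (M : structure L) (a : 'I_n -> M), models M T -> R c M a <-> sat a psi.
  apply: IH => // M N a b TM TN ab [N' [b' [TN' b'a cb' Qb']]].
  by exists N', b'; split=> //; apply: agree_on_trans ab.
have [psi1 qf1 H1] := RP id; have [psi0 qf0 H0] := RP not.
exists (Or (And p psi1) (And (Not p) psi0)) => //= M a TM; split=> [Qa|].
  have [ap|ap] := pselect (sat a p); [left|right]; split=> //.
    by apply/H1 => //; exists M, a; split=> //; apply: agree_on_refl.
  by apply/H0 => //; exists M, a; split=> //; apply: agree_on_refl.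
case=> [[ap /H1[]//]|[ap /H0[]//]] N [b [TN ba bp Qb]].
  by apply: QP Qb => //; split.
by apply: QP Qb => //; split=> //; split.
Qed.
End Separation.

(** * The signature and its axioms *)

Section Signature.
Variables (K : fieldType) (M : structure (LK K)).

Definition szero : M :=
  @fun_interp _ M (Zero K) (fun i : 'I_0 => match notF (ltn_ord i) with end).
Definition sadd (x y : M) : M :=
  @fun_interp _ M (Add K) (fun i : 'I_2 => if i == ord0 then x else y).
Definition sscale (l : K) (x : M) : M := @fun_interp _ M (Scale l) (fun _ : 'I_1 => x).
Definition sX k (x : M) : Prop := @rel_interp (LK K) M k (fun _ : 'I_1 => x).

Lemma eval_tzero n (e : 'I_n -> M) : eval e (@tzero K n) = szero.
Proof. by rewrite /= /szero; congr fun_interp; apply: funext; case. Qed.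

Lemma eval_tadd n (e : 'I_n -> M) t u : eval e (tadd t u) = sadd (eval e t) (eval e u).
Proof. by rewrite /= /sadd; congr fun_interp; apply: funext => i; case: ifP. Qed.

Lemma eval_tscale n (e : 'I_n -> M) l t : eval e (tscale l t) = sscale l (eval e t).
Proof. by []. Qed.

Lemma eval_v0 n (e : 'I_n -> M) a : eval (env_cons a e) v0 = a.
Proof. exact: env_cons0. Qed.

Lemma eval_v1 n (e : 'I_n -> M) a b : eval (env_cons a (env_cons b e)) v1 = b.
Proof. by rewrite /= env_consS env_cons0. Qed.

Lemma eval_v2 n (e : 'I_n -> M) a b c :
  eval (env_cons a (env_cons b (env_cons c e))) v2 = c.
Proof. by rewrite /= !env_consS env_cons0. Qed.

Definition evalE := (eval_tzero, eval_tadd, eval_tscale, eval_v0, eval_v1, eval_v2).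

Lemma sat_Eq n (e : 'I_n -> M) (t u : term (LK K) n) :
  sat e (Eq t u) = (eval e t = eval e u).
Proof. by []. Qed.

Lemma sat_inX n (e : 'I_n -> M) k (t : term (LK K) n) :
  sat e (inX k t) = sX k (eval e t).
Proof. by []. Qed.

Lemma eval_sum n (e : 'I_n -> M) k (t : 'I_k -> term (LK K) n) :
  eval e (\big[@tadd K n/@tzero K n]_(i < k) t i) = \big[sadd/szero]_(i < k) eval e (t i).
Proof. by apply: big_morph => [t1 t2|]; rewrite !evalE. Qed.
End Signature.

Section Meaning.
Variables (K : fieldType) (M : structure (LK K)).
Local Notation szero := (szero M).

Definition different_axes k (a : 'I_k -> M) : Prop :=
  (forall i, sX 1 (a i) /\ a i <> szero) /\
  (forall i j, i != j -> ~ sX 1 (sadd (a i) (a j))).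

Lemma sat_distinct_axes n (e : 'I_n -> M) k (t : 'I_k -> term (LK K) n) :
  sat e (distinct_axes t) <-> different_axes (fun i => eval e (t i)).
Proof.
rewrite /distinct_axes sat_And !sat_bigAnd /different_axes; split=> -[nz np]; split.
- by move=> i; have := nz i isT; rewrite -[szero](eval_tzero e).
- by move=> i j ij; have /sat_bigAnd/(_ j ij) := np i isT; rewrite -eval_tadd.
- by move=> i _; have := nz i; rewrite -[szero](eval_tzero e).
by move=> i _; apply/sat_bigAnd => j ij; have := np i j ij; rewrite -eval_tadd.
Qed.

Definition noenv : 'I_0 -> M := fun i => match notF (ltn_ord i) with end.

Lemma holds_Xn_def k : holds M (Xn_def K k) <-> forall x, sX k x <->
  exists y : 'I_k -> M, (forall i, sX 1 (y i)) /\ x = \big[@sadd K M/szero]_(i < k) y i.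
Proof.
pose p : formula (LK K) 1 := Exs k (And
  (\big[@And (LK K) (k + 1)/Top]_(i < k) X (Var (lshift 1 i)))
  (Eq (Var (rshift k ord0))
      (\big[@tadd K (k + 1)/@tzero K (k + 1)]_(i < k) Var (lshift 1 i)))).
change (Xn_def K k) with (All (Iff (inX k v0) p)).
suff H (e : 'I_0 -> M) x : sat (env_cons x e) p <->
    exists y : 'I_k -> M, (forall i, sX 1 (y i)) /\
      x = \big[@sadd K M/szero]_(i < k) y i.
  split=> HM; last first.
    by move=> e; rewrite sat_All => x; rewrite sat_Iff sat_inX eval_v0 H.
  by move: (HM noenv); rewrite sat_All => {}HM x; move: (HM x);
    rewrite sat_Iff sat_inX eval_v0 H.
rewrite /p sat_Exs; split=> -[y yP]; exists y.
  move: yP; rewrite sat_And sat_Eq eval_sum /= env_catr env_cons0 => -[/sat_bigAnd y1 ->].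
  split; last by apply: eq_bigr => i _; rewrite env_catl.
  by move=> i; have := y1 i isT; rewrite /X sat_inX /= env_catl.
move: yP => [y1 xE]; rewrite sat_And sat_Eq eval_sum /= env_catr env_cons0 xE; split.
  by apply/sat_bigAnd => i _; rewrite /X sat_inX /= env_catl.
by apply: eq_bigr => i _; rewrite env_catl.
Qed.

Lemma holds_at_least_axes k : holds M (at_least_axes K k) <->
  exists a : 'I_k -> M, different_axes a.
Proof.
suff H (e : 'I_0 -> M) : sat e (at_least_axes K k) <-> exists a : 'I_k -> M, different_axes a.
  by split=> [/(_ noenv)/H //|h e]; apply/H.
rewrite /at_least_axes sat_Exs; split=> -[a aP]; exists a.
  move/sat_distinct_axes: aP; congr different_axes.
  by apply: funext => i /=; rewrite env_catl.
apply/sat_distinct_axes; move: aP; congr different_axes.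
by apply: funext => i /=; rewrite env_catl.
Qed.

Lemma holds_axes_no_relation k (lam : 'I_k -> K) : holds M (axes_no_relation lam) <->
  forall a : 'I_k -> M, different_axes a ->
    \big[@sadd K M/szero]_(i < k) sscale (lam i) (a i) <> szero.
Proof.
suff H (e : 'I_0 -> M) : sat e (axes_no_relation lam) <->
    forall a : 'I_k -> M, different_axes a ->
    \big[@sadd K M/szero]_(i < k) sscale (lam i) (a i) <> szero.
  by split=> [/(_ noenv)/H //|h e]; apply/H.
have aE (a : 'I_k -> M) :
    (fun i => eval (env_cat a e) (Var (lshift 0 i) : term (LK K) (k + 0))) = a.
  by apply: funext => i /=; rewrite env_catl.
have sE (a : 'I_k -> M) : eval (env_cat a e)
    (\big[@tadd K (k + 0)/@tzero K (k + 0)]_(i < k) tscale (lam i) (Var (lshift 0 i))) =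
    \big[@sadd K M/szero]_(i < k) sscale (lam i) (a i).
  by rewrite eval_sum; apply: eq_bigr => i _; rewrite eval_tscale /= env_catl.
rewrite /axes_no_relation sat_Alls; split=> h a.
  move=> aD; have := h a; rewrite -sE -[szero](eval_tzero (env_cat a e)); apply.
  by apply/sat_distinct_axes; rewrite aE.
move=> /sat_distinct_axes; rewrite aE => /h.
by rewrite -sE -[szero](eval_tzero (env_cat a e)).
Qed.
End Meaning.

(** * Models as spaces with axes *)

Section FromModel.
Variables (K : fieldType) (M : structure (LK K)).
Hypothesis TM : models M (TK K).

(** Keeping the hypothesis in the type lets the module structure that it yields
    be inferred. *)
Definition model_space (_ : models M (TK K)) : Type := M.
Local Notation V := (model_space TM).
Local Notation e0 := (@noenv K M).
Local Notation "x +s y" := (@sadd K M x y) (at level 50).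

Lemma model_addA : associative (@sadd K M).
Proof.
move=> x y z.
have : sat (env_cons z (env_cons y (env_cons x e0))) (Eq _ _) := TM (vs_addA K) e0 x y z.
by rewrite sat_Eq !evalE.
Qed.

Lemma model_addC : commutative (@sadd K M).
Proof.
move=> x y.
have : sat (env_cons y (env_cons x e0)) (Eq _ _) := TM (vs_addC K) e0 x y.
by rewrite sat_Eq !evalE.
Qed.

Lemma model_add0 : left_id (szero M) (@sadd K M).
Proof.
move=> x.
have : sat (env_cons x e0) (Eq _ _) := TM (vs_add0 K) e0 x.
by rewrite sat_Eq !evalE.
Qed.

Lemma model_scaleA (l m : K) (x : M) : sscale l (sscale m x) = sscale (l * m) x.
Proof.
have : sat (env_cons x e0) (Eq _ _) := TM (vs_scaleA l m) e0 x.
by rewrite sat_Eq !evalE.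
Qed.

Lemma model_scale1 : left_id (1 : K) (@sscale K M).
Proof.
move=> x.
have : sat (env_cons x e0) (Eq _ _) := TM (vs_scale1 K) e0 x.
by rewrite sat_Eq !evalE.
Qed.

Lemma model_scaleDr : right_distributive (@sscale K M) (@sadd K M).
Proof.
move=> l x y.
have : sat (env_cons y (env_cons x e0)) (Eq _ _) := TM (vs_scaleDr l) e0 x y.
by rewrite sat_Eq !evalE.
Qed.

Lemma model_scaleDl (x : M) (l m : K) :
  sscale (l + m) x = sscale l x +s sscale m x.
Proof.
have : sat (env_cons x e0) (Eq _ _) := TM (vs_scaleDl l m) e0 x.
by rewrite sat_Eq !evalE.
Qed.

(** Only the existence of opposites is an axiom; that the opposite is the
    multiple by -1 follows from cancellation. *)
Lemma model_addN : left_inverse (szero M) (@sscale K M (-1)) (@sadd K M).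
Proof.
have cancel0 (x : M) : x +s x = x -> x = szero M.
  move=> xx; have [y] := TM (vs_addN K) e0 x.
  rewrite -/(sat (env_cons y (env_cons x e0)) (Eq _ _)) sat_Eq !evalE => xy.
  by rewrite -{1}[x]model_add0 -{1}xy model_addC model_addA xx.
move=> x; rewrite -{2}[x]model_scale1 -model_scaleDl addNr.
by apply: cancel0; rewrite -model_scaleDl addr0.
Qed.

HB.instance Definition _ := gen_eqMixin V.
HB.instance Definition _ := gen_choiceMixin V.
HB.instance Definition _ := GRing.isZmodule.Build V
  model_addA model_addC model_add0 model_addN.
HB.instance Definition _ := GRing.Zmodule_isLmodule.Build K V
  model_scaleA model_scale1 model_scaleDr model_scaleDl.

Definition model_X : pred V := fun x => `[< sX 1 (x : M) >].

Lemma model_XP (x : V) : reflect (sX 1 (x : M)) (model_X x).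
Proof. exact: asboolP. Qed.

Lemma model_XZ (l : K) (x : V) : model_X x -> model_X (l *: x).
Proof.
have : sat (env_cons (x : M) e0) (Imp (X v0) (X (tscale l v0))) := TM (X_scale l) e0 x.
by rewrite sat_Imp /X !sat_inX !evalE => H /model_XP/H Xlx; apply/model_XP.
Qed.

Lemma model_X0 : model_X 0.
Proof.
have /holds_at_least_axes[a aX] := TM (infinitely_many_axes K 1).
have /model_XP/(model_XZ 0) := (aX.1 ord0).1.
by rewrite (scale0r (a ord0 : V)).
Qed.

Lemma model_parallel_trans (x y z : V) : y != 0 -> model_X x -> model_X y -> model_X z ->
  model_X (x + y) -> model_X (y + z) -> model_X (x + z).
Proof.
move=> y0 Xx Xy Xz Xxy Xyz.
have [->|x0] := eqVneq x 0; first by rewrite add0r.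
have [->|z0] := eqVneq z 0; first by rewrite addr0.
have : sat (env_cons (z : M) (env_cons (y : M) (env_cons (x : M) e0)))
    (Imp (And (Xnz v2) (And (Xnz v1) (Xnz v0)))
         (Imp (And (par v2 v1) (par v1 v0)) (par v2 v0))) := TM (par_trans K) e0 x y z.
rewrite /Xnz /par /X !sat_Imp !sat_And !sat_Not !sat_inX !sat_Eq !evalE => H.
move: x0 y0 z0 => /eqP x0 /eqP y0 /eqP z0.
apply/model_XP; apply: H; repeat split => //; exact/model_XP.
Qed.

Lemma model_different_frame k (a : 'I_k -> M) :
  different_axes a -> frame model_X [seq (a i : V) | i <- enum 'I_k].
Proof.
move=> [aX ad]; have aij i j : model_X ((a i : V) + a j) -> i = j.
  by move=> /model_XP aij; apply: contrapT => /eqP/ad; apply.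
split.
- rewrite map_inj_uniq ?enum_uniq // => i j aE; apply: aij; rewrite -aE.
  rewrite -mulr2n -scaler_nat; apply: model_XZ; apply/model_XP; exact: (aX i).1.
- move=> _ /mapP[i _ ->]; apply/andP; split; first by apply/model_XP; exact: (aX i).1.
  by apply/eqP => ai0; case: (aX i) => _; apply.
by move=> _ _ /mapP[i _ ->] /mapP[j _ ->] /andP[_ /aij->].
Qed.

Lemma model_frame_different (E : seq V) : frame model_X E ->
  different_axes (fun i : 'I_(size E) => (nth 0 E i : M)).
Proof.
move=> fE; split=> [i|i j /eqP ij Xij].
  have [_ EX _] := fE; have /andP[Xi /eqP i0] := EX _ (mem_nth 0 (ltn_ord i)).
  by split; [apply/model_XP|exact: i0].
by apply/ij/(frame_nth fE)/model_XP.
Qed.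

Lemma model_frame_free (E : seq V) : frame model_X E -> \sum_(e <- E) e = 0 -> E = [::].
Proof.
case: E => [//|e E] fE E0; exfalso.
have lam : exists i : 'I_(size E).+1, (fun=> 1 : K) i != 0 by exists ord0; rewrite oner_eq0.
have /holds_axes_no_relation H := TM (axes_independent lam).
apply: H (model_frame_different fE) _.
transitivity (\sum_(i < size (e :: E)) (e :: E)`_i).
  by apply: eq_bigr => i _; rewrite /= model_scale1.
by rewrite -(big_mkord xpredT (fun i => (e :: E)`_i)) -(big_nth 0 xpredT id) E0.
Qed.

Lemma model_frame_large k : exists2 E, frame model_X E & size E = k.
Proof.
have /holds_at_least_axes[a /model_different_frame aE] := TM (infinitely_many_axes K k).
by exists [seq (a i : V) | i <- enum 'I_k]; rewrite // size_map size_enum_ord.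
Qed.

Definition axial_of_model : axialSpace K :=
  AxialSpace model_X0 model_XZ model_parallel_trans model_frame_free model_frame_large.

(** The axiom on X^k speaks of exactly k summands, [inXn] of at most k; a shorter
    sum is padded with zeros. *)
Lemma model_XnP k (x : V) : sX k (x : M) <-> @inXn K axial_of_model k x.
Proof.
have /holds_Xn_def -> := TM (X_power K k).
split=> [[y [Xy ->]]|[ys [sys Xys ->]]].
  exists [seq (y i : V) | i <- enum 'I_k]; split.
  - by rewrite size_map size_enum_ord.
  - by apply/allP => _ /mapP[i _ ->]; apply/model_XP.
  by rewrite big_map big_enum.
exists (fun i : 'I_k => nth 0 ys i); split.
  move=> i; apply/model_XP; have [si|si] := ltnP i (size ys).
    by apply: (allP Xys); apply: mem_nth.
  by rewrite nth_default // model_X0.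
exact/esym/(@sum_nth V).
Qed.
End FromModel.

(** * Spaces with axes as models *)

Section ToModel.
Variables (K : fieldType) (V : axialSpace K).

Definition axial_structure : structure (LK K) :=
  @Structure (LK K) V (inhabits 0)
    (fun f => match f return ('I_(LK_fun_arity f) -> V) -> V with
       | Zero => fun _ => 0
       | Add => fun a => a ord0 + a ord_max
       | Scale l => fun a => l *: a ord0
     end)
    (fun k a => inXn k (a ord0)).
Local Notation M := axial_structure.

Lemma axial_sadd : @sadd K M = +%R.
Proof. by apply: funext => x; apply: funext => y. Qed.

Lemma axial_sX1 (x : V) : sX (M := M) 1 x <-> onX x.
Proof. exact: inXn1. Qed.

Lemma axial_big k (F : 'I_k -> V) :
  \big[@sadd K M/szero M]_(i < k) F i = \sum_(i < k) F i.
Proof. by rewrite axial_sadd. Qed.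

Lemma axial_Xn_def k : holds M (Xn_def K k).
Proof.
apply/holds_Xn_def => x; rewrite /sX /=; split=> [[ys [sys Xys ->]]|[y [Xy ->]]].
  exists (fun i : 'I_k => nth 0 ys i); split=> [i|].
    apply/axial_sX1; have [si|si] := ltnP i (size ys).
      by apply: (allP Xys); apply: mem_nth.
    by rewrite nth_default // onX0.
  by rewrite axial_big sum_nth.
rewrite axial_big; exists (codom y); rewrite size_codom card_ord big_image.
split=> //; apply/allP => _ /codomP[i ->]; apply/axial_sX1; apply: Xy.
Qed.

Lemma axial_at_least_axes k : holds M (at_least_axes K k).
Proof.
apply/holds_at_least_axes; have [E fE <-] := frame_large V k.
exists (fun i => nth 0 E i); split=> [i|i j /eqP ij Xij].
  have [_ EX _] := fE; have /andP[Xi /eqP i0] := EX _ (mem_nth 0 (ltn_ord i)).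
  by split; [exact/axial_sX1|exact: i0].
by apply/ij/(frame_nth fE)/axial_sX1; move: Xij; rewrite axial_sadd.
Qed.

(** The component of a vanishing combination on the axis of [a i0] is
    [lam i0 *: a i0]. *)
Lemma axial_no_relation k (lam : 'I_k.+1 -> K) : (exists i, lam i != 0) ->
  holds M (axes_no_relation lam).
Proof.
move=> [i0 lam0]; apply/holds_axes_no_relation => a [aX ad].
rewrite axial_big => s0.
have Xa i : onX (a i : V) by apply/axial_sX1; case: (aX i).
have a0 : (a i0 : V) != 0 by apply/eqP; case: (aX i0).
have : component (a i0 : V) (\sum_(i < k.+1) lam i *: (a i : V)) = lam i0 *: (a i0 : V).
  rewrite component_sum //; last by move=> i _ _; exists 1%N; apply/inXn1/onXZ.
  rewrite (bigD1 i0) //= component_onX ?onXZ // ?axisZ ?axis_refl // big1 ?addr0 // => j ji.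
  have kj : inXn 1 (a j : V) by apply/inXn1.
  rewrite (componentZ (Xa i0) a0 _ kj) component_onX // ifF ?scaler0 //.
  apply/negP => /andP[_ Xij]; case: (ad i0 j); rewrite 1?eq_sym //.
  by rewrite axial_sadd; apply/axial_sX1.
rewrite [X in component _ X](_ : _ = 0) // component0 // => /esym/eqP.
by rewrite scaler_eq0 (negPf lam0) (negPf a0).
Qed.

Lemma axial_models : models M (TK K).
Proof.
move=> _ [||||l m||l|l m|l|k||||k|k lam].
- by move=> e; rewrite sat_All => x; rewrite sat_All => y; rewrite sat_All => z;
  rewrite sat_Eq !evalE axial_sadd addrA.
- by move=> e; rewrite sat_All => x; rewrite sat_All => y;
  rewrite sat_Eq !evalE axial_sadd addrC.
- by move=> e; rewrite sat_All => x; rewrite sat_Eq !evalE axial_sadd; apply: add0r.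
- move=> e; rewrite sat_All => x; rewrite sat_Ex; exists (- (x : V));
  rewrite sat_Eq !evalE axial_sadd; exact: addrN.
- by move=> e; rewrite sat_All => x; rewrite sat_Eq !evalE; apply: scalerA.
- by move=> e; rewrite sat_All => x; rewrite sat_Eq !evalE; apply: scale1r.
- by move=> e; rewrite sat_All => x; rewrite sat_All => y;
  rewrite sat_Eq !evalE axial_sadd; apply: scalerDr.
- by move=> e; rewrite sat_All => x; rewrite sat_Eq !evalE axial_sadd; apply: scalerDl.
- move=> e; rewrite sat_All => x; rewrite sat_Imp /X !sat_inX !evalE => /axial_sX1 Xx.
  exact/axial_sX1/onXZ.
- exact: axial_Xn_def.
- move=> e; rewrite sat_All => x; rewrite sat_Imp /Xnz /par /X sat_And.
  rewrite !sat_inX !evalE axial_sadd.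
  by move=> [/axial_sX1 Xx _]; apply/axial_sX1; case/andP: (axis_refl Xx).
- move=> e; rewrite sat_All => x; rewrite sat_All => y;
  rewrite !sat_Imp /par /X !sat_inX !evalE axial_sadd => _.
  by rewrite addrC.
- move=> e; rewrite sat_All => x; rewrite sat_All => y; rewrite sat_All => z;
  rewrite !sat_Imp /Xnz /par /X !sat_And.
  rewrite !sat_inX !sat_Not !sat_Eq !evalE axial_sadd !axial_sX1.
  move=> [[Xx _] [[Xy y0] [Xz _]]] [Xxy Xyz].
  by apply: parallel_trans Xy Xz Xxy Xyz => //; apply/eqP.
- exact: axial_at_least_axes.
exact: axial_no_relation.
Qed.
End ToModel.

(** * The space of polynomials *)

Section PolySpace.
Variable K : fieldType.

Definition monomial : pred {poly K} := fun p => `[< exists c i, p = c *: 'X^i >].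

Lemma monomialP p : reflect (exists c i, p = c *: 'X^i) (monomial p).
Proof. exact: asboolP. Qed.

Lemma monomial_same (a b c : K) i j l : a != 0 -> b != 0 ->
  a *: 'X^i + b *: 'X^j = c *: 'X^l -> i = j.
Proof.
move=> a0 b0 E; apply: contrapT => /eqP ij.
have Ei : a = c * (i == l)%:R.
  have := congr1 (fun p : {poly K} => p`_i) E.
  by rewrite coefD !coefZ !coefXn eqxx (negPf ij) mulr0 mulr1 addr0.
have Ej : b = c * (j == l)%:R.
  have := congr1 (fun p : {poly K} => p`_j) E.
  by rewrite coefD !coefZ !coefXn eqxx [j == i]eq_sym (negPf ij) mulr0 mulr1 add0r.
case: (i =P l) Ei => [il _|_]; last by rewrite mulr0 => /eqP; rewrite (negPf a0).
by move: Ej; rewrite -il eq_sym (negPf ij) mulr0 => /eqP; rewrite (negPf b0).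
Qed.

Lemma monomial0 : monomial 0.
Proof. by apply/monomialP; exists 0, 0%N; rewrite scale0r. Qed.

Lemma monomialZ a p : monomial p -> monomial (a *: p).
Proof.
move=> /monomialP[c [i ->]]; apply/monomialP.
by exists (a * c), i; rewrite scalerA.
Qed.

Lemma monomial_trans p q r : q != 0 -> monomial p -> monomial q -> monomial r ->
  monomial (p + q) -> monomial (q + r) -> monomial (p + r).
Proof.
move=> q0 /monomialP[a [i ->]] /monomialP[b [j qE]] /monomialP[c [l ->]].
move=> /monomialP[d [m]]; rewrite {}qE in q0 *.
have b0 : b != 0 by apply: contra q0 => /eqP->; rewrite scale0r.
have [->|a0] := eqVneq a 0.
  by rewrite scale0r add0r => _ _; apply/monomialP; exists c, l; rewrite add0r.
have [->|c0] := eqVneq c 0.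
  by rewrite scale0r addr0 => _ _; apply/monomialP; exists a, i; rewrite addr0.
move=> /(monomial_same a0 b0)-> /monomialP[d' [m' /(monomial_same b0 c0)->]].
by apply/monomialP; exists (a + c), l; rewrite scalerDl.
Qed.

(** In a frame the monomials have distinct degrees, so the leading entry e is not
    cancelled at its degree. *)
Lemma monomial_frame_free E : frame monomial E -> \sum_(e <- E) e = 0 -> E = [::].
Proof.
case: E => [//|e E] [/= /andP[eE uE] EX Einj]; rewrite big_cons => E0; exfalso.
have /andP[/monomialP[a [i ei]] e0] := EX e (mem_head _ _).
have := congr1 (fun p : {poly K} => p`_i) E0.
rewrite coefD coef_sum big_seq big1 => [|f fE].
  rewrite coef0 addr0 ei coefZ coefXn eqxx mulr1 => a0.
  by case/eqP: e0; rewrite ei a0 scale0r.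
have fE' : f \in e :: E by rewrite inE fE orbT.
have /andP[Xf _] := EX f fE'; have /monomialP[b [j fj]] := Xf.
rewrite fj coefZ coefXn; case: (i =P j) => [ij|]; last by rewrite mulr0.
case/negP: eE; rewrite (Einj e f) ?mem_head //.
by rewrite /on_axis Xf; apply/monomialP; exists (a + b), i; rewrite ei fj ij scalerDl.
Qed.

Lemma monomial_frame_large k : exists2 E, frame monomial E & size E = k.
Proof.
exists [seq 'X^i | i <- iota 0 k]; last by rewrite size_map size_iota.
have Xinj i j : 'X^i + 'X^j \in monomial -> i = j.
  move=> /monomialP[c [l E]]; apply: (@monomial_same 1 1 c i j l); rewrite ?oner_eq0 //.
  by rewrite !scale1r.
have X1 i : monomial 'X^i by apply/monomialP; exists 1, i; rewrite scale1r.
split.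
- rewrite map_inj_uniq ?iota_uniq // => i j ij; apply: Xinj; rewrite ij.
  by rewrite -mulr2n -scaler_nat; apply: monomialZ.
- by move=> _ /mapP[i _ ->]; rewrite X1 -size_poly_eq0 size_polyXn.
by move=> _ _ /mapP[i _ ->] /mapP[j _ ->] /andP[_ /Xinj->].
Qed.

Definition poly_space : axialSpace K :=
  AxialSpace monomial0 monomialZ monomial_trans monomial_frame_free monomial_frame_large.
End PolySpace.

(** * Quantifier elimination and completeness *)

Section Elimination.
Variable K : fieldType.
Hypothesis K_infinite : infinite_set [set: K].
Local Notation space TM := (axial_of_model TM).

Lemma term_lincomb n (t : term (LK K) n) : exists l : {ffun 'I_n -> K},
  forall (M : structure (LK K)) (TM : models M (TK K)) (e : 'I_n -> M),
  eval e t = lincomb l (e : 'I_n -> space TM).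
Proof.
elim: t => [i|[||c] ts IH].
- exists [ffun j => (j == i)%:R] => M TM e.
  rewrite /lincomb (bigD1 i) //= ffunE eqxx scale1r big1 ?addr0 // => j ji.
  by rewrite ffunE (negPf ji) scale0r.
- exists 0 => M TM e; rewrite /lincomb big1 => [|i _]; last by rewrite ffunE scale0r.
  rewrite /=; change (fun_interp (fun i => eval e (ts i)) = szero M).
  by rewrite /szero; congr fun_interp; apply: funext; case.
- have [l1 H1] := IH ord0; have [l2 H2] := IH ord_max.
  exists (l1 + l2) => M TM e.
  transitivity (sadd (eval e (ts ord0)) (eval e (ts ord_max))).
    rewrite /sadd /=; congr fun_interp; apply: funext => i; case: ifP => [/eqP->//|].
    by case: i => -[|[|//]] //= i _; congr (eval e (ts _)); apply: val_inj.
  rewrite (H1 M TM e) (H2 M TM e) /lincomb.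
  under [RHS]eq_bigr do rewrite ffunE scalerDl.
  by rewrite big_split.
have [l H] := IH ord0; exists [ffun i => c * l i] => M TM e.
transitivity (sscale c (eval e (ts ord0))).
  by rewrite /sscale /=; congr fun_interp; apply: funext => i; rewrite ord1.
rewrite (H M TM e) /lincomb.
under [RHS]eq_bigr do rewrite ffunE -scalerA.
by rewrite -scaler_sumr.
Qed.

Definition determined n (S : seq ({ffun 'I_n -> K} * nat)) (phi : formula (LK K) n) :=
  forall (M N : structure (LK K)) (TM : models M (TK K)) (TN : models N (TK K))
    (a : 'I_n -> M) (b : 'I_n -> N),
  agree S (a : 'I_n -> space TM) (b : 'I_n -> space TN) -> sat a phi <-> sat b phi.

Lemma determined_cat n S1 S2 (phi1 phi2 : formula (LK K) n) :
  determined S1 phi1 -> determined S2 phi2 ->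
  [/\ determined (S1 ++ S2) (And phi1 phi2), determined (S1 ++ S2) (Or phi1 phi2) &
      determined (S1 ++ S2) (Imp phi1 phi2)].
Proof.
move=> H1 H2; split=> M N TM TN a b ab /=;
  (have /H1-> : agree S1 (a : 'I_n -> space TM) (b : 'I_n -> space TN)
    by apply: agree_sub ab => s; rewrite mem_cat => ->);
  (have /H2-> // : agree S2 (a : 'I_n -> space TM) (b : 'I_n -> space TN)
    by apply: agree_sub ab => s; rewrite mem_cat orbC => ->).
Qed.

Lemma formula_determined n (phi : formula (LK K) n) : exists S, determined S phi.
Proof.
elim: phi => {n} [n|n t u|n k ts|n p [S1 H1] q [S2 H2]|n p [S1 H1] q [S2 H2]
    |n p [S1 H1] q [S2 H2]|n p [S H]|n p [S H]].
- by exists [::].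
- have [l1 E1] := term_lincomb t; have [l2 E2] := term_lincomb u.
  exists [:: (l1 - l2, 0%N)] => M N TM TN a b ab.
  have eqE (Q : structure (LK K)) (TQ : models Q (TK K)) (e : 'I_n -> Q) :
      sat e (Eq t u) <-> inXn 0 (lincomb (l1 - l2) (e : 'I_n -> space TQ)).
    rewrite sat_Eq (E1 Q TQ) (E2 Q TQ).
    have -> : lincomb (l1 - l2) (e : 'I_n -> space TQ) =
        lincomb l1 (e : 'I_n -> space TQ) - lincomb l2 (e : 'I_n -> space TQ).
      by rewrite /lincomb -sumrB; apply: eq_bigr => i _; rewrite !ffunE scalerBl.
    split=> [->|[[|y ys] [//= _ _]]]; first by rewrite subrr; apply: inXn0.
    by rewrite big_nil => /eqP; rewrite subr_eq0 => /eqP.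
  by rewrite (eqE _ TM) (eqE _ TN); apply: (ab (_, _)); rewrite mem_head.
- have [l E] := term_lincomb (ts ord0).
  exists [:: (l, k)] => M N TM TN a b ab.
  have relE (Q : structure (LK K)) (TQ : models Q (TK K)) (e : 'I_n -> Q) :
      sat e (Rel k ts) <-> inXn k (lincomb l (e : 'I_n -> space TQ)).
    rewrite -model_XnP -(E Q TQ) /sX /=.
    rewrite (_ : (fun i => _) = (fun=> eval e (ts ord0))) //.
    by apply: funext => i; rewrite ord1.
  by rewrite (relE _ TM) (relE _ TN); apply: (ab (_, _)); rewrite mem_head.
- by exists (S1 ++ S2); case: (determined_cat H1 H2).
- by exists (S1 ++ S2); case: (determined_cat H1 H2).
- by exists (S1 ++ S2); case: (determined_cat H1 H2).
- have [S' S'P] := extends_all K_infinite S.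
  exists S' => M N TM TN a b ab; split=> h x.
    have [y _ /agree_sym yx] := S'P _ _ _ _ (agree_sym ab) x I.
    exact/(H M N TM TN _ _ yx)/h.
  have [y _ xy] := S'P _ _ _ _ ab x I.
  exact/(H M N TM TN _ _ xy)/h.
have [S' S'P] := extends_all K_infinite S.
exists S' => M N TM TN a b ab; split=> -[x h].
  have [y _ xy] := S'P _ _ _ _ ab x I; exists y.
  exact/(H M N TM TN _ _ xy).
have [y _ /agree_sym yx] := S'P _ _ _ _ (agree_sym ab) x I; exists y.
exact/(H M N TM TN _ _ yx).
Qed.

Definition lincomb_term n (l : {ffun 'I_n -> K}) : term (LK K) n :=
  \big[@tadd K n/@tzero K n]_(i < n) tscale (l i) (Var i).

Lemma sat_lincomb_term n (p : {ffun 'I_n -> K} * nat) (M : structure (LK K))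
    (TM : models M (TK K)) (a : 'I_n -> M) :
  sat a (inX p.2 (lincomb_term p.1)) <-> inXn p.2 (lincomb p.1 (a : 'I_n -> space TM)).
Proof. by rewrite sat_inX -model_XnP eval_sum. Qed.

Lemma TK_eliminates : eliminates_quantifiers (TK K).
Proof.
move=> n phi; have [S SP] := formula_determined phi.
pose atom (p : {ffun 'I_n -> K} * nat) := inX p.2 (lincomb_term p.1).
have qfS : all_qf (map atom S) by elim: S {SP} => //= p S IH.
have agreeS (M N : structure (LK K)) (TM : models M (TK K)) (TN : models N (TK K))
    (a : 'I_n -> M) (b : 'I_n -> N) : agree_on (map atom S) a b ->
    agree S (a : 'I_n -> space TM) (b : 'I_n -> space TN).
  elim: S {SP qfS} => [|p S IH] [] // ab /IH abS q.
  rewrite inE => /predU1P[->|/abS//].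
  by rewrite -!sat_lincomb_term.
have [psi qf psiP] := @qf_definable (LK K) (TK K) n (map atom S)
  (fun M a => sat a phi) qfS
  (fun M N a b TM TN ab => (SP M N TM TN a b (agreeS M N TM TN a b ab)).1).
by exists psi => // M TM e; apply: psiP.
Qed.

(** Over the empty tuple every linear combination is zero, so any two models
    agree on every list of conditions. *)
Lemma TK_complete : complete_theory (TK K).
Proof.
pose M0 := axial_structure (poly_space K).
have TM0 : models M0 (TK K)  := @axial_models K (poly_space K).
split=> [|phi]; first by exists M0.
have [S SP] := formula_determined phi.
have same (M : structure (LK K)) (TM : models M (TK K)) (e : 'I_0 -> M) (e0 : 'I_0 -> M0) :
    sat e phi <-> sat e0 phi.
  apply: (SP _ _ TM TM0) => p _; rewrite /lincomb !big_ord0.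
  by split=> _; apply: inXn0.
have [H|H] := pselect (sat (@noenv K M0) phi); [left|right] => M TM e.
  exact/(same M TM e (@noenv K M0)).
by rewrite sat_Not => /(same M TM e (@noenv K M0)).
Qed.
End Elimination.

Theorem theorem3p12 (K : fieldType) (K_infinite : infinite_set [set: K]) :
  eliminates_quantifiers (TK K) /\ complete_theory (TK K).
Proof. by split; [apply: TK_eliminates|apply: TK_complete]. Qed.
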